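(* Let $k$ be a field of characteristic zero. Let $r,t_1,s_1,t_2,s_2\geq 0$ be integers and $c_1,c_2\in k$, with $t_2\leq t_1$ and $(t_1,s_1)\neq(t_2,s_2)$. Let $d$ denote the $k$-derivation $y^r\partial_x + (c_1x^{t_1}y^{s_1}+c_2x^{t_2}y^{s_2})\partial_y$ of the polynomial ring $k[x,y]$. Then $d$ is a simple derivation of $k[x,y]$ if and only if all of the following conditions are satisfied: (a) $c_1\neq 0$, $c_2\neq 0$ and $t_2<t_1$. (b) If $r>0$, then $t_2=s_2=0$ and $s_1>0$. (c) If $r=0$, then $s_1+s_2>0$ and $s_1s_2=0$. (d) If $r=s_1=0$ and $s_2=1$, then $(t_2+1)\nmid(t_1-t_2)$.
   Context: A derivation $d$ of a commutative ring $A$ with unity is a map $d:A\to A$ with $d(a+b)=d(a)+d(b)$ and $d(ab)=a\,d(b)+b\,d(a)$ for all $a,b\in A$; if $A$ is a $k$-algebra, a $k$-derivation is a derivation that is also $k$-linear. An ideal $I$ of $A$ is $d$-differential if $d(I)\subseteq I$. The derivation $d$ is called simple if $\{0\}$ and $A$ are the only $d$-differential ideals of $A$. For $P,Q\in k[x,y]$, $P\partial_x+Q\partial_y$ denotes the unique $k$-derivation of $k[x,y]$ sending $x\mapsto P$ and $y\mapsto Q$. *)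

(* Defs.v *)
From mathcomp Require Import all_boot all_order all_algebra.
From mathcomp Require Import mpoly.

Set Implicit Arguments.
Unset Strict Implicit.
Unset Printing Implicit Defensive.

Import GRing.Theory.
Local Open Scope ring_scope.

Definition derivation (A : comNzRingType) (d : A -> A) : Prop :=
  (forall a b, d (a + b) = d a + d b) /\
  (forall a b, d (a * b) = a * d b + b * d a).

(* Ideals are Prop-valued predicates, and A itself counts as an ideal; the
   library's [idealr_closed] is boolean and excludes the improper ideal. *)
Definition ideal (A : comNzRingType) (I : A -> Prop) : Prop :=
  [/\ I 0,
      forall a b, I a -> I b -> I (a + b)
    & forall a b, I b -> I (a * b)].

Definition differential (A : comNzRingType) (d : A -> A) (I : A -> Prop) :
    Prop :=
  forall a, I a -> I (d a).

Definition simple_derivation (A : comNzRingType) (d : A -> A) : Prop :=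
  derivation d /\
  forall I : A -> Prop, ideal I -> differential d I ->
    (forall a, I a <-> a = 0) \/ (forall a, I a).

Section PlaneDerivations.
Variable k : fieldType.
Implicit Types (P Q f : {mpoly k[2]}).

Definition varx : {mpoly k[2]} := 'X_ord0.
Definition vary : {mpoly k[2]} := 'X_ord_max.

Definition k_derivation (d : {mpoly k[2]} -> {mpoly k[2]}) : Prop :=
  derivation d /\ forall (c : k) f, d (c *: f) = c *: d f.

Definition plane_derivation P Q f : {mpoly k[2]} :=
  P * mderiv ord0 f + Q * mderiv ord_max f.

Lemma mderivXU (i j : 'I_2) : mderiv i 'X_j = (i == j)%:R :> {mpoly k[2]}.
Proof.
rewrite mderivX mnm1E eq_sym.
case: eqP => [->|_]; last by rewrite scale0r.
suff -> : (U_(j) - U_(j) = 0)%MM by rewrite mpolyX0 scale1r.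
by apply/mnmP => l; rewrite mnmBE subnn mnm0E.
Qed.

Lemma plane_derivation_k P Q : k_derivation (plane_derivation P Q).
Proof.
rewrite /plane_derivation; split; first split=> [a b|a b].
- by rewrite !mderivD !mulrDr addrACA.
- rewrite !mderivM !mulrDr addrACA addrC.
  by rewrite ![P * (a * _)]mulrCA ![Q * (a * _)]mulrCA ![b * (_ * _)]mulrCA
             ![b * mderiv _ _]mulrC.
- by move=> c f; rewrite !mderivZ -!scalerAr scalerDr.
Qed.

Lemma plane_derivation_x P Q : plane_derivation P Q varx = P.
Proof. by rewrite /plane_derivation !mderivXU mulr1 mulr0 addr0. Qed.

Lemma plane_derivation_y P Q : plane_derivation P Q vary = Q.
Proof. by rewrite /plane_derivation !mderivXU mulr1 mulr0 add0r. Qed.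

Lemma k_derivation_ext (d e : {mpoly k[2]} -> {mpoly k[2]}) :
  k_derivation d -> k_derivation e ->
  d varx = e varx -> d vary = e vary -> d =1 e.
Proof.
move=> [[dD dM] dZ] [[eD eM] eZ] ex ey.
have at1 (h : {mpoly k[2]} -> {mpoly k[2]}) :
    (forall a b, h (a * b) = a * h b + b * h a) -> h 1 = 0.
  move=> hM; apply: (@addrI _ (h 1)); rewrite addr0.
  by have := hM 1 1; rewrite !mul1r => <-.
have eqM a b : d a = e a -> d b = e b -> d (a * b) = e (a * b).
  by move=> Ha Hb; rewrite dM eM Ha Hb.
have eqX a n : d a = e a -> d (a ^+ n) = e (a ^+ n).
  move=> Ha; elim: n => [|n IHn]; first by rewrite expr0 !at1.
  by rewrite exprS; apply: eqM.
elim/mpolyind => [|c m p _ _ IHp].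
  by rewrite -(scale0r (1 : {mpoly k[2]})) dZ eZ !scale0r.
rewrite dD eD IHp dZ eZ; congr (_ *: _ + _).
rewrite mpolyXE_id big_ord_recl big_ord1; apply: eqM; apply: eqX => //.
Qed.

Lemma plane_derivation_unique P Q (d : {mpoly k[2]} -> {mpoly k[2]}) :
  k_derivation d -> d varx = P -> d vary = Q -> d =1 plane_derivation P Q.
Proof.
move=> dk dx dy; apply: k_derivation_ext => //; first exact: plane_derivation_k.
  by rewrite plane_derivation_x.
by rewrite plane_derivation_y.
Qed.

End PlaneDerivations.

(* Main.v *)
Require Import Defs.
From mathcomp Require Import all_boot all_order all_algebra.
From mathcomp Require Import mpoly.
From mathcomp Require Import polyXY ring zify.
From Stdlib Require Import Classical.

Set Implicit Arguments.
Unset Strict Implicit.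
Unset Printing Implicit Defensive.

Import GRing.Theory.
Local Open Scope ring_scope.

(** The vector field y^r d/dx + (a x^p y^s + b x^q) d/dy is written [d] below.

    Each condition of the theorem is necessary because its failure produces a
    proper nonzero differential ideal. Most of these are generated by a
    Darboux polynomial, i.e. some F with d F = lam F: a separated right-hand
    side x^t g(y) has the invariant lines g = 0 or a first integral
    ([separated_not_simple]), and a polynomial solution y = h(x) is an
    invariant graph ([graph_darboux]). For r > 0 the ideal (d x, d y) is
    differential, so it has to contain 1 ([size_coef0_simple]).

    Conversely, let I be a nonzero differential ideal. If I contains some
    nonzero g(x), then it contains a power of d x = y^r, which is 1 for r = 0;
    for r > 0 it then contains a power of d y too, and d y is congruent to a
    nonzero constant modulo y ([differential_power], [comaximal_powers]).
    Otherwise a primitive element of least y-degree of the ideal that I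
    generates in k(x)[y] is a Darboux polynomial of positive y-degree, by the
    Gauss lemma ([darboux_of_ideal]). So it remains to see that no Darboux
    polynomial f involves y.

    If r = 0, s = 1 and p < q, the two leading coefficients of f give a polynomial
    solution of h' = a x^p h + b x^q, and looking at exponents modulo p + 1
    shows when there is one ([linear_ode_dvdn]). If r = 0, s > 1 and p < q,
    the substitution u = 1/y exchanges the two monomials and turns r into
    s - 2 ([darboux_const_gt]). Everything is thus reduced to q < p, the
    subject of [no_darboux].

    There the curve f = 0 is expanded at x = infinity, in coordinates
    x = tau^-s, y = tau^t z with t = p - q, which give a x^p y^s and b x^q
    the same weight. Up to a power of tau, f becomes G(tau, z) with
    G0 = G(0, z) nonzero, and the equation reads V G_z = mu G + O(tau^K), where
    V = a z^s + b. The roots of G0 are therefore roots of V; each of them is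
    a family of branches y ~ rho x^(-t/s) of the curve. In the coefficient of
    tau^K the derivative d/dx enters for the first time and creates double
    poles of G_z / G at these roots. Since d log G is closed, that coefficient
    is the z-derivative of a rational function, so its residues vanish. This
    determines the coefficient of z^r in mu at order tau^K. But the cofactor
    lam is a polynomial and has no monomial y^r / x, so that coefficient is
    known too. The comparison ([local_index]) reads

      s N + t (r + 1) deg G0 = 0,

    where N is the weighted degree of f. Here N is nonnegative, because
    G0(0) is nonzero and so some power of x alone has that weight. Hence
    N = 0 and deg G0 = 0, which forces f to be constant. *)
(** * Univariate polynomials: logarithmic derivatives and a residue identity *)
(** Lets [ring] derive an identity from a hypothesis: [c] is the multiplier
    that certifies it. *)
Lemma eq_lincomb (R : pzRingType) (c l r x y : R) :
  l = r -> x - y = c * (l - r) -> x = y.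
Proof. by move=> ->; rewrite subrr mulr0 => /subr0_eq. Qed.

Section Univariate.
Variable k : fieldType.
Hypothesis char0 : [pchar k] =i pred0.
Implicit Types A B V p : {poly k}.

Lemma natr_neq0 n : (0 < n)%N -> n%:R != 0 :> k.
Proof. by move/pcharf0P: char0 => ->; rewrite lt0n. Qed.

Lemma natr_inj m n : m%:R = n%:R :> k -> m = n.
Proof.
wlog le_mn : m n / (m <= n)%N.
  by move=> th eq_mn; case: (leqP m n) => [|/ltnW] /th; [apply | move=> ->].
move=> eq_mn; apply/eqP; rewrite eqn_leq le_mn -subn_eq0 /=.
by move/pcharf0P: char0 => <-; rewrite natrB // eq_mn subrr.
Qed.

Lemma size_deriv0 p : size p^`() = (size p).-1.
Proof.
have [->|p0] := eqVneq p 0; first by rewrite deriv0 size_poly0.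
have [sz1|sz2] := leqP (size p) 1.
  by rewrite (size1_polyC sz1) derivC size_poly0 size_polyC; case: eqP.
apply/eqP; rewrite eqn_leq; apply/andP; split.
  by have := lt_size_deriv p0; case: (size p) sz2.
rewrite leqNgt; apply/negP => lt_sz.
have /eqP : (p^`())`_(size p).-2 = 0 by apply: nth_default; move: lt_sz;
  case: (size p) sz2 => [|[]].
rewrite coef_deriv -mulr_natr mulf_eq0 (negPf (natr_neq0 _)) // orbF.
have -> : (size p).-2.+1 = (size p).-1 by move: sz2; lia.
by rewrite -lead_coefE lead_coef_eq0 (negPf p0).
Qed.

Lemma dvdp_deriv p : (p %| p^`()) = (size p <= 1)%N.
Proof.
apply/idP/idP => [dv|sz1]; last by rewrite (size1_polyC sz1) derivC dvdp0.
have [->|p0] := eqVneq p 0; first by rewrite size_poly0.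
have [d0|d0] := eqVneq p^`() 0.
  by have := size_deriv0 p; rewrite d0 size_poly0; case: (size p) => [|[]].
have := dvdp_leq d0 dv; rewrite size_deriv0.
by move: p0; rewrite -size_poly_gt0; case: (size p) => // n _; rewrite ltnn.
Qed.

(** At a root of [B], of order m, the derivative of the reduced fraction
    A / B has a pole of order m + 1 >= 2, and a separable [V] can only lower
    this order by one. The squarefree part [C] of [B] makes the argument work
    without roots: it would have to divide [V] twice. *)
Lemma size1_of_log_primitive V A B nu :
    coprimep V V^`() -> coprimep A B -> B != 0 ->
  V * (A^`() * B - A * B^`()) = nu * B ^+ 2 -> size B = 1%N.
Proof.
move=> cV cAB B0 eqV.
pose D := gcdp B B^`(); pose C := B %/ D; pose E := B^`() %/ D.
have D0 : D != 0 by rewrite gcdp_eq0 negb_and B0.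
have eB : B = C * D by rewrite divpK ?dvdp_gcdl.
have eB' : B^`() = E * D by rewrite divpK ?dvdp_gcdr.
have C0 : C != 0 by apply: contraNneq B0 => C0; rewrite eB C0 mul0r.
have cCE : coprimep C E by apply: coprimep_div_gcd; rewrite B0.
have cCA : coprimep C A.
  by rewrite coprimep_sym; apply: (coprimep_dvdl _ cAB); rewrite eB dvdp_mulr.
clearbody E C D.
have eq1 : V * (A^`() * C - A * E) = nu * C ^+ 2 * D.
  by apply: (mulIf D0); move: eqV; rewrite eB' eB => eqV;
    apply: (eq_lincomb (c := 1) eqV); ring.
have dvC W X : W * (A^`() * C - A * E) = C * X -> C %| W.
  move=> eqW; have : C %| W * (A * E).
    have -> : W * (A * E) = C * (W * A^`() - X) by apply: (eq_lincomb (c := -1)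
      eqW); ring.
    exact: dvdp_mulr.
  by rewrite mulrA Gauss_dvdpl // Gauss_dvdpl.
have /dvdpP[V1 eV] : C %| V by apply: (dvC V (nu * C * D)); rewrite eq1; ring.
have /dvdpP[V2 eV1] : C %| V1.
  apply: (dvC V1 (nu * D)); apply: (mulIf C0).
  by move: eq1; rewrite eV => eq1; apply: (eq_lincomb (c := 1) eq1); ring.
have dvCV : C %| V by rewrite eV dvdp_mull.
have dvCV' : C %| V^`().
  rewrite eV derivM dvdp_add //; first exact: dvdp_mull.
  by rewrite eV1 dvdp_mulr // dvdp_mull.
have szC : size C == 1%N.
  rewrite -coprimepp; apply: (coprimep_dvdr dvCV).
  exact: (coprimep_dvdl dvCV').
have : B %| B^`().
  rewrite eB' eB; have /size_poly1P[c c0 ->] := szC.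
  by rewrite mul_polyC dvdpZl // dvdp_mull.
rewrite dvdp_deriv => szB; apply/eqP; rewrite eqn_leq szB.
by rewrite size_poly_gt0.
Qed.

(** The hypothesis says that V (A / B)' is a polynomial; then A / B is one. *)
Lemma dvdp_of_log_primitive V A B nu :
    coprimep V V^`() -> B != 0 ->
  V * (A^`() * B - A * B^`()) = nu * B ^+ 2 -> B %| A.
Proof.
move=> cV B0 eqV; pose g := gcdp A B.
have g0 : g != 0 by rewrite gcdp_eq0 negb_and B0 orbT.
pose A1 := A %/ g; pose B1 := B %/ g.
have eA : A = A1 * g by rewrite divpK ?dvdp_gcdl.
have eB : B = B1 * g by rewrite divpK ?dvdp_gcdr.
have B10 : B1 != 0 by apply: contraNneq B0 => B10; rewrite eB B10 mul0r.
have cAB : coprimep A1 B1 by apply: coprimep_div_gcd; rewrite B0 orbT.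
have gA : g %| A by apply: dvdp_gcdl.
clearbody A1 B1 g.
have /eqP/size_poly1P[c c0 eB1] : size B1 = 1%N.
  apply: (size1_of_log_primitive (nu := nu) cV cAB B10).
  have g20 : g ^+ 2 != 0 by rewrite expf_neq0.
  apply: (mulIf g20); move: eqV; rewrite eA eB !derivM => eqV.
  by apply: (eq_lincomb (c := 1) eqV); ring.
by rewrite eB eB1 mul_polyC dvdpZl.
Qed.

Lemma coef_XMderiv (R : nzRingType) (p : {poly R}) i :
  ('X * p^`())`_i = p`_i *+ i.
Proof. by rewrite coefXM; case: i => [|i]; rewrite ?mulr0n ?coef_deriv. Qed.

Section Binomial.
Variables (a b : k) (s : nat).
Hypotheses (a0 : a != 0) (b0 : b != 0) (s0 : (0 < s)%N).

(** The common top-weight part of the vector field, dehomogenized. *)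
Definition binom : {poly k} := a%:P * 'X^s + b%:P.

Lemma XMderiv_binom : 'X * binom^`() = s%:R * (binom - b%:P).
Proof.
rewrite /binom derivD derivC addr0 deriv_mulC derivXn addrK.
by rewrite -mulr_natl -[in RHS](prednK s0) exprS prednK //; ring.
Qed.

Lemma size_binom : size binom = s.+1.
Proof.
by rewrite /binom mul_polyC size_polyDl size_scale ?size_polyXn // size_polyC b0.
Qed.

Lemma coprime_binom_deriv : coprimep binom binom^`().
Proof.
apply/Bezout_coprimepP; exists (s%:R%:P, - 'X) => /=.
rewrite mulNr XMderiv_binom -polyC_natr.
have -> : s%:R%:P * binom - s%:R%:P * (binom - b%:P) = (s%:R * b)%:P.
  by rewrite polyCM; ring.
by rewrite polyC_eqp1 mulf_neq0 ?natr_neq0.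
Qed.

Lemma coprime_Xn_binom r : coprimep 'X^r binom.
Proof.
have : coprimep 'X binom.
  rewrite coprimep_sym coprimepX /root /binom !hornerE expr0n.
  by rewrite eqn0Ngt s0 mulr0 add0r.
exact: coprimep_expl.
Qed.

(** This is the vanishing of residues, summed over the roots of [B], in a form
    that needs no roots. In the application [A / B] is the coefficient of
    tau^K in tau G_tau / G, and [e / B] is the logarithmic derivative of G0.
    The term in [e] is the one that gives (A / B)' double poles. Since
    [z^2 binom (e / B)'] has the same polar part as [b s z (e / B)], a
    multiple of [z^(r+2) e / B] cancels these poles, and
    [dvdp_of_log_primitive] leaves a polynomial [Q] with
    [binom Q' = K nu]. As z^r divides [nu] and [nu] has degree at most r + s,
    [Q'] is a constant times z^r; the conclusion compares the coefficients of
    z^r and z^(r+s). *)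
Lemma index_identity (A B e mu0 muK : {poly k}) (K m v t r : nat) :
    (0 < K)%N -> B != 0 ->
    s%:R * (binom * (A^`() * B - A * B^`())) =
      K%:R * (B * (s%:R * muK * B + v%:R * ('X^r * B) - t%:R * ('X^(r.+1) * e))) ->
    binom * e = mu0 * B -> (size mu0 <= s)%N ->
    (size muK <= maxn r.+1 s)%N ->
    (forall j, (j < r)%N -> muK`_j = 0) -> muK`_r = - m%:R ->
  (t * r.+1)%:R * mu0`_s.-1 = a * s%:R * (v%:R - s%:R * m%:R).
Proof.
move=> K0 B0 eqA eqe sz_mu0 sz_muK muK_low muK_r.
pose V := binom.
pose nu := s%:R * b%:P * (s%:R * muK + v%:R * 'X^r)
           + t%:R * 'X^(r.+1) * ((r.+2%:R - s%:R) * mu0 + 'X * mu0^`()).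
pose A2 := s%:R ^+ 2 * b%:P * A + K%:R * t%:R * ('X^(r.+2) * e).
(* The multiplier of [z^(r+2) e] in [A2] is the one that cancels double poles. *)
have eqA2 : V * (A2^`() * B - A2 * B^`()) = (K%:R * nu) * B ^+ 2.
  have eqe' : V^`() * e + V * e^`() = mu0^`() * B + mu0 * B^`().
    by rewrite -!derivM eqe.
  have eqV := XMderiv_binom; rewrite -/V in eqA eqe eqV.
  have -> : A2^`() = s%:R ^+ 2 * b%:P * A^`()
      + K%:R * t%:R * (r.+2%:R * 'X^(r.+1) * e + 'X^(r.+2) * e^`()).
    have dX : ('X^(r.+2))^`() = r.+2%:R * 'X^(r.+1) :> {poly k}.
      by rewrite derivXn mulr_natl.
    rewrite /A2 -!polyC_natr -polyC_exp -!polyCM; move: 'X^(r.+2) dX => X2 dX.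
    by rewrite derivD !derivM !derivC dX -!polyC_natr; ring.
  pose u : {poly k} := K%:R * t%:R * 'X^(r.+1).
  rewrite /A2 /nu (exprS 'X r.+1).
  transitivity (K%:R * (s%:R * b%:P * (s%:R * muK + v%:R * 'X^r) +
      t%:R * 'X^(r.+1) * ((r.+2%:R - s%:R) * mu0 + 'X * mu0^`())) * B ^+ 2
    + (s%:R * b%:P * (s%:R * (V * (A^`() * B - A * B^`()))
        - K%:R * (B * (s%:R * muK * B + v%:R * ('X^r * B) - t%:R * ('X^(r.+1) * e))))
      + u * 'X * B * (V^`() * e + V * e^`() - (mu0^`() * B + mu0 * B^`()))
      + u * (r.+2%:R * B - 'X * B^`() - s%:R * B) * (V * e - mu0 * B)
      - u * e * B * ('X * V^`() - s%:R * (V - b%:P)))).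
    by rewrite /u; ring.
  by rewrite eqA eqe' eqe eqV !subrr !mulr0 subr0 !addr0.
have s_natr n (p : {poly k}) : n%:R * p = n%:R *: p by rewrite -mul_polyC polyC_natr.
have [Q eA2] : exists Q, A2 = Q * B.
  apply/dvdpP; apply: dvdp_of_log_primitive eqA2 => //.
  exact: coprime_binom_deriv.
have B20 : B ^+ 2 != 0 by rewrite expf_neq0.
have eqQ : V * Q^`() = K%:R * nu.
  apply: (mulIf B20); rewrite -eqA2 eA2 derivM; ring.
have [M eM] : exists M, muK = 'X^r * M.
  exists (drop_poly r muK); rewrite -[LHS](poly_take_drop r) mulrC.
  suff -> : take_poly r muK = 0 by rewrite add0r.
  by apply/polyP => j; rewrite coef_take_poly coef0; case: ifP => // /muK_low.
have coefM i : M`_i = muK`_(i + r).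
  by rewrite eM coefXnM ltnNge leq_addl /= addnK.
pose nu1 := s%:R * b%:P * (s%:R * M + v%:R)
            + t%:R * ('X * ((r.+2%:R - s%:R) * mu0 + 'X * mu0^`())).
have enu : nu = 'X^r * nu1 by rewrite /nu /nu1 eM exprSr; ring.
have [W eW] : exists W, Q^`() = W * 'X^r.
  apply/dvdpP; rewrite -(Gauss_dvdpr _ (coprime_Xn_binom r)) -/V eqQ enu.
  by rewrite mulrCA dvdp_mulr.
have Xr0 : 'X^r != 0 :> {poly k} by rewrite monic_neq0 ?monicXn.
have eqW : V * W = K%:R * nu1.
  by apply: (mulIf Xr0); rewrite -mulrA -eW eqQ enu; ring.
have coef_natM n (p : {poly k}) i : (n%:R * p)`_i = n%:R * p`_i.
  by rewrite s_natr coefZ.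
have coef_nu1 i : nu1`_i.+1 = s%:R * b * (s%:R * M`_i.+1)
    + t%:R * ((r.+2%:R - s%:R) * mu0`_i + mu0`_i *+ i).
  rewrite coefD -mulrA coef_natM coefCM coefD coef_natM -polyC_natr coefC addr0.
  rewrite coef_natM coefXM /= coefD coef_XMderiv mulrBl coefB !coef_natM; ring.
have sz_nu1 : (size nu1 <= s.+1)%N.
  apply/leq_sizeP => -[//|i] lt_si; rewrite coef_nu1 coefM.
  rewrite [muK`__]nth_default; last first.
    by apply: leq_trans sz_muK _; rewrite geq_max; apply/andP; split;
       move: s0 lt_si; lia.
  by rewrite [mu0`__]nth_default ?(leq_trans sz_mu0) // mul0rn !(mulr0, addr0).
have sz_W : (size W <= 1)%N.
  have [->|W0] := eqVneq W 0; first by rewrite size_poly0.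
  have V0 : V != 0 by rewrite -size_poly_gt0 size_binom.
  have : (size (V * W)%R <= s.+1)%N.
    rewrite eqW s_natr; exact: leq_trans (size_scale_leq _ _) sz_nu1.
  by rewrite size_mul // size_binom addSn /= -addn1 leq_add2l.
have K0' := natr_neq0 K0.
have coefV i : V`_i = a * (i == s)%:R + b * (i == 0%N)%:R.
  by rewrite coefD coefCM coefXn coefC; case: (i == 0%N); rewrite ?mulr1 ?mulr0.
have coefVW i : V`_i * W`_0 = K%:R * nu1`_i.
  by rewrite -coef_natM -eqW [W in RHS](size1_polyC sz_W) coefMC.
have s00 : (s == 0%N) = false by rewrite eqn0Ngt s0.
have V0 : V`_0 = b by rewrite coefV eq_sym s00 mulr0 mulr1 add0r.
have Vs : V`_s = a by rewrite coefV eqxx s00 mulr0 mulr1 addr0.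
have eq0 : b * W`_0 = K%:R * (s%:R * b * (v%:R - s%:R * m%:R)).
  rewrite -V0 coefVW V0 coefD -mulrA !(coef_natM, coefCM) coefXM /= mulr0 addr0.
  by rewrite coefD coef_natM -polyC_natr coefC /= coefM add0n muK_r; ring.
have eqs : a * W`_0 = K%:R * (t%:R * (r.+1%:R * mu0`_s.-1)).
  have nu_s := coef_nu1 s.-1; rewrite (prednK s0) coefM in nu_s.
  rewrite -Vs coefVW nu_s [muK`__]nth_default; last first.
    by apply: leq_trans sz_muK _; rewrite geq_max; move: s0; lia.
  have es : s%:R = s.-1%:R + 1 :> k by rewrite natr1 prednK.
  by rewrite -mulr_natl -!natr1 es; ring.
apply: (mulfI (mulf_neq0 K0' b0)).
transitivity (b * (a * W`_0)); first by rewrite eqs natrM; ring.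
by rewrite mulrCA eq0; ring.
Qed.
End Binomial.

End Univariate.

(** * Formal expansion of a logarithmic derivative *)
Lemma Xn_factor (R : nzRingType) (p : {poly R}) : p != 0 ->
  exists v q, p = 'X^v * q /\ q`_0 != 0.
Proof.
elim: (size p) {-2}p (leqnn (size p)) => {p} [|n IHn] p.
  by rewrite leqn0 size_poly_eq0 => ->.
move=> sz_p p0; have [p_0|p_0] := eqVneq p`_0 0; last by exists 0, p; rewrite mul1r.
have ep : p = 'X * drop_poly 1 p.
  apply/polyP => -[|i]; first by rewrite coefXM.
  by rewrite coefXM coef_drop_poly addn1.
have [||v [q [eq q0]]] := IHn (drop_poly 1 p).
- by rewrite size_drop_poly leq_subLR.
- by apply: contraNneq p0 => d0; rewrite ep d0 mulr0.
by exists v.+1, q; rewrite ep eq mulrA -exprS.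
Qed.

Section InnerDerivative.
Variable R : comNzRingType.
Implicit Types (f g : {poly {poly R}}) (p : {poly R}).

(** The derivative with respect to the coefficient variable. *)
Definition deriv_inner f : {poly {poly R}} := swapXY (swapXY f)^`().

Lemma coef_deriv_inner f i : (deriv_inner f)`_i = (f`_i)^`().
Proof.
by apply/polyP => j; rewrite coef_swapXY !coef_deriv coefMn coef_swapXY.
Qed.

Lemma deriv_innerD f g : deriv_inner (f + g) = deriv_inner f + deriv_inner g.
Proof.
by apply/polyP => i; rewrite coefD !coef_deriv_inner coefD derivD.
Qed.

Lemma deriv_innerN f : deriv_inner (- f) = - deriv_inner f.
Proof. by apply/polyP => i; rewrite coefN !coef_deriv_inner coefN derivN. Qed.

Lemma deriv_innerB f g : deriv_inner (f - g) = deriv_inner f - deriv_inner g.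
Proof. by rewrite deriv_innerD deriv_innerN. Qed.

Lemma deriv_innerM f g : deriv_inner (f * g) = deriv_inner f * g + f * deriv_inner g.
Proof.
apply/polyP => i; rewrite coef_deriv_inner coefD !coefM raddf_sum -big_split /=.
by apply: eq_bigr => j _; rewrite derivM !coef_deriv_inner.
Qed.

Lemma deriv_innerC p : deriv_inner p%:P = p^`()%:P.
Proof.
by apply/polyP => i; rewrite coef_deriv_inner !coefC; case: eqP; rewrite ?deriv0.
Qed.

Lemma deriv_innerXn n : deriv_inner 'X^n = 0.
Proof.
apply/polyP => i; rewrite coef_deriv_inner coefXn coef0; case: eqP => _.
  by rewrite derivC.
by rewrite deriv0.
Qed.

Lemma deriv_innerX : deriv_inner 'X = 0.
Proof. by rewrite -(deriv_innerXn 1) expr1. Qed.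

Lemma deriv_inner_deriv f : deriv_inner f^`() = (deriv_inner f)^`().
Proof.
apply/polyP => i; rewrite !(coef_deriv_inner, coef_deriv); exact: derivMn.
Qed.

Lemma size_deriv_inner f : (size (deriv_inner f) <= size f)%N.
Proof.
by apply/leq_sizeP => i le_i; rewrite coef_deriv_inner nth_default ?deriv0.
Qed.

End InnerDerivative.

Section LogDerivative.
Variable k : fieldType.
Hypothesis char0 : [pchar k] =i pred0.

(* G(0,z) is inverted modulo a power of tau *)
(** A geometric series in [G`_0 - G], which is divisible by tau. *)
Lemma truncated_inverse (G : {poly {poly k}}) M :
  exists H E, G * H = (G`_0 ^+ M)%:P - 'X^M * E.
Proof.
pose B := drop_poly 1 G.
have eG : G = (G`_0)%:P - - ('X * B).
  rewrite -[LHS](poly_take_drop 1) opprK mulrC expr1; congr (_ + _).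
  by apply/polyP => -[|j]; rewrite coef_take_poly coefC.
exists (\sum_(i < M) (G`_0)%:P ^+ (M.-1 - i) * (- ('X * B)) ^+ i), ((- B) ^+ M).
by rewrite {1}eG -subrXX -mulrN exprMn polyC_exp.
Qed.

Lemma coefXnMD n (p q : {poly {poly k}}) i : (i < n)%N -> (p + 'X^n * q)`_i = p`_i.
Proof. by move=> lt_in; rewrite coefD coefXnM lt_in addr0. Qed.

(** The form d log G is closed: applying tau d/dtau to G_z / G, or d/dz to
    tau G_tau / G, gives the same. Here [H / g] is the inverse of [G] modulo
    tau^M, and denominators are cleared. *)
Lemma log_derivative_closed (G H E : {poly {poly k}}) g M K :
    (K < M)%N -> G * H = g%:P - 'X^M * E ->
  K%:R * ((deriv_inner G * H)`_K * g) =
    (('X * G^`() * H)`_K)^`() * g - ('X * G^`() * H)`_K * g^`().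
Proof.
move=> ltKM eGH; pose Y := deriv_inner G * H; pose T := 'X * G^`() * H.
have dX (F : {poly {poly k}}) i : ('X * F^`())`_i = i%:R * F`_i.
  by rewrite coef_XMderiv mulr_natl.
have e1 : 'X * (G * H)^`() = - 'X^M * (M%:R * E + 'X * E^`()).
  rewrite eGH derivB derivC sub0r derivM derivXn; case: M ltKM {eGH} => // M _.
  by rewrite -mulr_natl /= exprS; ring.
have e2 : deriv_inner (G * H) = g^`()%:P - 'X^M * deriv_inner E.
  by rewrite eGH deriv_innerB deriv_innerM deriv_innerC deriv_innerXn mul0r add0r.
have closed : G * H * ('X * Y^`() - deriv_inner T) =
    - (g^`()%:P * T) + 'X^M * (deriv_inner E * T - Y * (M%:R * E + 'X * E^`())).
  transitivity (Y * ('X * (G * H)^`()) - T * deriv_inner (G * H)); last first.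
    by rewrite e1 e2; ring.
  by rewrite /Y /T !derivM !deriv_innerM deriv_inner_deriv deriv_innerX; ring.
have := congr1 (fun F : {poly {poly k}} => F`_K) closed.
rewrite coefXnMD // coefN coefCM eGH.
have -> : (g%:P - 'X^M * E) * ('X * Y^`() - deriv_inner T) =
  g%:P * ('X * Y^`() - deriv_inner T) + 'X^M * (- E * ('X * Y^`() - deriv_inner T))
    by ring.
rewrite coefXnMD // coefCM coefB dX coef_deriv_inner -/T -/Y => eqK.
by apply: (eq_lincomb (c := 1) eqK); ring.
Qed.


Section Local.
Variables (a b : k) (s : nat).
Hypotheses (a0 : a != 0) (b0 : b != 0) (s0 : (0 < s)%N).
Local Notation V := (binom a b s).

(** The leading terms of both sides give the coefficient of [mu]. At z = 0 a
    root of [p] of order e > 0 would have order e - 1 on the left, because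
    [V] does not vanish there, and at least e on the right. *)
Lemma binom_cofactor (p mu : {poly k}) : p != 0 -> V * p^`() = mu * p ->
  [/\ (size mu <= s)%N, mu`_s.-1 = a * (size p).-1%:R & p`_0 != 0].
Proof.
move=> p0 eqp.
have p_0 : p`_0 != 0.
  have [e [g [ep g0]]] := Xn_factor p0.
  case: e ep => [|e] ep; first by rewrite ep mul1r.
  have Xe0 : 'X^e != 0 :> {poly k} by rewrite monic_neq0 ?monicXn.
  have eqX : V * (e.+1%:R * g + 'X * g^`()) = 'X * (mu * g).
    apply: (mulfI Xe0).
    have dX : ('X^(e.+1))^`() = e.+1%:R * 'X^e :> {poly k}.
      by rewrite derivXn mulr_natl.
    move: eqp; rewrite ep derivM dX exprS => eqp.
    by apply: (eq_lincomb (c := 1) eqp); ring.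
  have V_0 : V`_0 = b.
    by rewrite coefD coefCM coefXn coefC /= eq_sym eqn0Ngt s0 mulr0 add0r.
  have /eqP := coefXM (mu * g) 0.
  rewrite -eqX coef0M V_0 [_`_0]coefD coefXM addr0 -polyC_natr coefCM.
  by rewrite !mulf_eq0 (negPf b0) (negPf g0) (negPf (natr_neq0 char0 _)).
have [p'0|p'0] := eqVneq p^`() 0.
  have -> : mu = 0.
    by move/eqP: eqp; rewrite p'0 mulr0 eq_sym mulf_eq0 (negPf p0) orbF => /eqP.
  rewrite size_poly0 coef0; split=> //.
  by rewrite -(size_deriv0 char0) p'0 size_poly0 mulr0.
have V0 : V != 0 by rewrite -size_poly_gt0 (size_binom a0 b0 s0).
have mu0 : mu != 0 by apply: contraTneq (mulf_neq0 V0 p'0) => mu0;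
  rewrite eqp mu0 mul0r eqxx.
have szp : (1 < size p)%N.
  by rewrite ltnNge; apply: contra p'0 => /size1_polyC ->; rewrite derivC.
have := congr1 (fun q : {poly k} => size q) eqp.
rewrite !size_mul // (size_binom a0 b0 s0) (size_deriv0 char0) => eqsz.
have szmu : size mu = s by move: eqsz szp;
  move: (size p) (size mu) => [|[|n]] M //; lia.
split=> //; first by rewrite szmu.
have := congr1 lead_coef eqp; rewrite !lead_coefM.
have -> : lead_coef V = a.
  rewrite lead_coefE (size_binom a0 b0 s0) coefD coefCM coefXn coefC /= eqxx.
  by rewrite eqn0Ngt s0 mulr1 addr0.
have -> : lead_coef p^`() = (size p).-1%:R * lead_coef p.
  rewrite !lead_coefE (size_deriv0 char0) coef_deriv mulr_natl.
  by rewrite prednK // -subn1 subn_gt0.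
rewrite mulrA => /mulIf; rewrite lead_coef_eq0 => /(_ p0) ->.
by rewrite lead_coefE szmu.
Qed.

(** The equation satisfied by [G] is solved for G_z / G: order tau^0 is the
    setting of [binom_cofactor], and order tau^K that of [index_identity]. *)
Lemma local_index (G mu : {poly {poly k}}) (K m v t r : nat) :
    G`_0 != 0 -> (0 < K)%N ->
    s%:R * (V%:P * deriv_inner G) - 'X^K * (('X^r)%:P
        * ('X * G^`() + v%:R * G - t%:R * ('X%:P * deriv_inner G)))
      = s%:R * (mu * G) ->
    (size (mu`_K)%R <= maxn r.+1 s)%N ->
    (forall j, (j < r)%N -> mu`_K`_j = 0) -> mu`_K`_r = - m%:R ->
  [/\ G`_0`_0 != 0, mu`_0`_s.-1 = a * (size (G`_0)%R).-1%:R &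
    (t * r.+1 * (size (G`_0)%R).-1)%:R = s%:R * (v%:R - s%:R * m%:R) :> k].
Proof.
move=> G0 K0 pde sz_muK muK_low muK_r.
have coef_natM n (p : {poly {poly k}}) i : (n%:R * p)`_i = n%:R * p`_i.
  by rewrite -polyC_natr coefCM.
have natp0 n : (0 < n)%N -> n%:R != 0 :> {poly k}.
  by move=> n0; rewrite -polyC_natr polyC_eq0 natr_neq0.
have pde0 : V * (G`_0)^`() = mu`_0 * G`_0.
  have := congr1 (fun F : {poly {poly k}} => F`_0) pde.
  rewrite coefB coefXnM K0 subr0 !coef_natM coefCM coef_deriv_inner coef0M.
  by move/mulfI; apply; apply: natp0.
have [sz_mu0 lead_mu0 G00] := binom_cofactor G0 pde0.
split=> //.
have [H [E eGH]] := truncated_inverse G K.+1.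
set B := G`_0 ^+ K.+1 in eGH.
have B0 : B != 0 by rewrite expf_neq0.
pose Y := deriv_inner G * H; pose T := 'X * G^`() * H.
have eqB : G`_0 * H`_0 = B.
  have := congr1 (fun F : {poly {poly k}} => F`_0) eGH.
  by rewrite coef0M coefB coefXnM coefC subr0.
have pdeH : s%:R * (V%:P * Y) - 'X^K * (('X^r)%:P
    * (T + v%:R * (B%:P - 'X^(K.+1) * E) - t%:R * ('X%:P * Y)))
    = s%:R * (mu * (B%:P - 'X^(K.+1) * E)).
  rewrite -eGH /Y /T.
  by apply: (eq_lincomb (c := H) pde); ring.
have pdeK : s%:R * (V * Y`_K) - 'X^r * (v%:R * B - t%:R * ('X * Y`_0))
    = s%:R * (mu`_K * B).
  have := congr1 (fun F : {poly {poly k}} => F`_K) pdeH.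
  have -> : s%:R * (mu * (B%:P - 'X^(K.+1) * E)) =
    s%:R * (B%:P * mu) + 'X^(K.+1) * (- s%:R * mu * E) by ring.
  rewrite coefXnMD // coefB coefXnM ltnn subnn !(coef_natM, coefCM) coefB coefD.
  rewrite !(coef_natM, coefCM) coefB coefXnM coefC /= subr0 /T -mulrA coefXM add0r.
  by move=> ->; ring.
have eqA := log_derivative_closed (ltnSn K) eGH.
have eqe : V * Y`_0 = mu`_0 * B.
  by rewrite coef0M coef_deriv_inner mulrA pde0 -mulrA eqB.
have := index_identity (A := T`_K) (B := B) (e := Y`_0) (mu0 := mu`_0)
  (muK := mu`_K) (m := m) (v := v) (t := t) char0 a0 b0 s0 K0 B0.
move/(_ r) => idx; have {}idx := idx _ eqe sz_mu0 sz_muK muK_low muK_r.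
apply: (mulfI a0); rewrite natrM mulrCA -lead_mu0 idx; first by ring.
rewrite -eqA -/Y exprS.
by apply: (eq_lincomb (c := K%:R * B) pdeK); ring.
Qed.

End Local.
End LogDerivative.

(** * Reversal of polynomials *)
Section Reversal.
Variable R : comNzRingType.
Implicit Types F G : {poly R}.

(** x^m F(1/x), for [F] of degree at most [m]. *)
Definition revp m F : {poly R} := \poly_(i < m.+1) F`_(m - i).

Lemma coef_revp m F i : (revp m F)`_i = if (i <= m)%N then F`_(m - i) else 0.
Proof. by rewrite coef_poly ltnS. Qed.

Lemma revpD m F G : revp m (F + G) = revp m F + revp m G.
Proof.
by apply/polyP => i; rewrite coefD !coef_revp; case: ifP; rewrite ?coefD ?addr0.
Qed.

Lemma revpCM m c F : revp m (c%:P * F) = c%:P * revp m F.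
Proof.
by apply/polyP => i; rewrite coefCM !coef_revp; case: ifP; rewrite ?coefCM ?mulr0.
Qed.

Lemma revp0 m : revp m 0 = 0 :> {poly R}.
Proof. by apply/polyP => i; rewrite coef_revp !coef0 if_same. Qed.

Lemma revpXn m i : (i <= m)%N -> revp m 'X^i = 'X^(m - i).
Proof.
move=> le_im; apply/polyP => j; rewrite coef_revp !coefXn; case: leqP => jm.
  by congr (_%:R); congr nat_of_bool; apply/eqP/eqP; lia.
by case: eqP => //; lia.
Qed.

Lemma revpXnM m i F : (size F <= m.+1)%N -> revp (i + m) ('X^i * F) = revp m F.
Proof.
move=> szF; apply/polyP => j; rewrite !coef_revp coefXnM.
case: (leqP j m) => jm.
  rewrite (leq_trans jm) ?leq_addl // ltnNge; have -> : (i <= i + m - j)%N by lia.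
  by congr (F`_ _); lia.
by case: ifP => // jim; rewrite ifT //; lia.
Qed.

Lemma revpM m n F G : (size F <= m.+1)%N -> (size G <= n.+1)%N ->
  revp (m + n) (F * G) = revp m F * revp n G.
Proof.
elim/poly_ind: F m => [|F c IHF] m szF szG; first by rewrite mul0r !revp0 mul0r.
have szc : (size (c%:P * G)%R <= n.+1)%N.
  by rewrite mul_polyC (leq_trans (size_scale_leq _ _)).
have eF : F * 'X + c%:P = 'X * F + c%:P * 'X^0 by rewrite mulr1 mulrC.
case: m szF => [|m] szF.
  have F0 : F = 0.
    apply/eqP; apply: contraTT szF => F0; rewrite -ltnNge size_MXaddC.
    by rewrite (negPf F0) ltnS size_poly_gt0.
  rewrite F0 mul0r add0r add0n revpCM; congr (_ * _).
  by rewrite -[c%:P]mulr1 -(expr0 'X) revpCM revpXn.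
have szF' : (size F <= m.+1)%N.
  by move: szF; rewrite size_MXaddC; case: ifP => // /andP[/eqP-> _];
    rewrite size_poly0.
rewrite eF mulrDl !revpD mulrDl; congr (_ + _).
  rewrite -mulrA -[in LHS](expr1 'X) -[in RHS](expr1 'X) -(add1n m) -addnA.
  rewrite !revpXnM ?IHF // (leq_trans (size_polyMleq _ _)) //.
  by move: szF' szG; move: (size F) (size G) => u w; lia.
rewrite -mulrA mul1r !revpCM -mulrA revpXn // subn0; congr (_ * _).
apply/polyP => j; rewrite coefXnM !coef_revp; case: leqP => jm; case: ltnP => jn.
- by rewrite leq_subLR leqNgt jn.
- by rewrite leq_subLR jn; congr (G`_ _); lia.
- by [].
- by apply: nth_default; apply: leq_trans szG _; lia.
Qed.

Lemma revp_shift i m F : (size F <= m.+1)%N ->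
  revp (i + m) F = 'X^i * revp m F.
Proof.
move=> szF; rewrite -[in LHS](mul1r F) revpM // ?size_poly1 //.
by rewrite -[1]/('X^0) revpXn // subn0.
Qed.

Lemma revp_euler m F : (size F <= m.+1)%N ->
  revp m ('X * F^`()) = m%:R * revp m F - 'X * (revp m F)^`().
Proof.
move=> szF; apply/polyP => i.
rewrite coefB -polyC_natr coefCM coef_XMderiv !coef_revp coef_XMderiv mulr_natl.
by case: leqP => le_im; rewrite ?mulrnBr // !mul0rn subrr.
Qed.

(** With xi = 1/x one has d/dx = - xi^2 d/dxi. *)
Lemma revp_deriv i m F : (size F <= m.+1)%N ->
  revp (i + m) F^`() = 'X^(i.+1) * (m%:R * revp m F - 'X * (revp m F)^`()).
Proof.
move=> szf; apply/polyP => e; rewrite coef_revp coefXnM ltnS coef_deriv.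
case: (leqP e i) => [le_ei|lt_ie].
  rewrite (leq_trans le_ei) ?leq_addr // nth_default ?mul0rn //.
  by apply: leq_trans szf _; lia.
rewrite coefB -polyC_natr coefCM coef_XMderiv coef_revp mulr_natl.
have -> : (e <= i + m)%N = (e - i.+1 < m)%N by lia.
case: (ltngtP (e - i.+1) m) => [lt_m|gt_m|->]; last by rewrite subrr.
  rewrite -mulrnBr 1?ltnW //; congr (F`_ _ *+ _); lia.
by rewrite !mul0rn subrr.
Qed.

End Reversal.

Lemma deriv_inner_revp (R : comNzRingType) m (f : {poly {poly R}}) : deriv_inner
  (revp m f) = revp m (deriv_inner f).
Proof.
apply/polyP => i; rewrite coef_deriv_inner !coef_revp; case: ifP => _.
  by rewrite coef_deriv_inner.
by rewrite deriv0.
Qed.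



(** * The weighted substitution *)
Section Substitution.
Variables (k : fieldType) (s t : nat).
Hypothesis s0 : (0 < s)%N.

Local Notation tz := ('X%:P * 'X^t : {poly {poly k}}).

(** The substitution xi = tau^s, y = tau^t z; [tau] is the outer variable of
    the target and [z] the inner one. *)
Definition subst_inner : {rmorphism {poly k} -> {poly {poly k}}} :=
  horner_eval tz \o map_poly (polyC \o polyC).

Definition wsubst : {rmorphism {poly {poly k}} -> {poly {poly k}}} :=
  horner_eval ('X^s : {poly {poly k}}) \o map_poly subst_inner.

Lemma subst_innerD : {morph subst_inner : g h / g + h}.
Proof. exact: rmorphD. Qed.

Lemma subst_innerM : {morph subst_inner : g h / g * h}.
Proof. exact: rmorphM. Qed.

Lemma wsubstD : {morph wsubst : F G / F + G}.
Proof. exact: rmorphD. Qed.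

Lemma wsubstM : {morph wsubst : F G / F * G}.
Proof. exact: rmorphM. Qed.

Lemma wsubstB : {morph wsubst : F G / F - G}.
Proof. exact: rmorphB. Qed.

Lemma wsubstXn n : wsubst 'X^n = 'X^(s * n).
Proof. by rewrite rmorphXn /= map_polyX /horner_eval hornerX -exprM. Qed.

Lemma subst_innerXn n : subst_inner 'X^n = ('X^n)%:P * 'X^(t * n).
Proof.
by rewrite rmorphXn /= map_polyX /horner_eval hornerX exprMn -polyC_exp -exprM.
Qed.

Lemma subst_inner0 : subst_inner 0 = 0.
Proof. exact: rmorph0. Qed.

Lemma wsubst0 : wsubst 0 = 0.
Proof. exact: rmorph0. Qed.

Lemma subst_innerX : subst_inner 'X = tz.
Proof. by rewrite /= map_polyX /horner_eval hornerX. Qed.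

Lemma subst_innerC c : subst_inner c%:P = c%:P%:P.
Proof. by rewrite /= map_polyC /horner_eval hornerC. Qed.

Lemma wsubstX : wsubst 'X = 'X^s.
Proof. by rewrite /= map_polyX /horner_eval hornerX. Qed.

Lemma wsubstC g : wsubst g%:P = subst_inner g.
Proof. by rewrite [LHS]/= map_polyC /horner_eval hornerC. Qed.

Lemma wsubst_deriv_inner F : deriv_inner (wsubst F) = 'X^t * wsubst (deriv_inner F).
Proof.
have inner g : deriv_inner (subst_inner g) = 'X^t * subst_inner g^`().
  elim/poly_ind: g => [|g c IHg]; first by rewrite deriv0 subst_inner0 mulr0
    -polyC0 deriv_innerC deriv0.
  rewrite subst_innerD subst_innerM subst_innerX subst_innerC deriv_innerD
    !deriv_innerM !deriv_innerC.
  rewrite deriv_innerXn derivX derivC derivMXaddC subst_innerD subst_innerM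
    subst_innerX IHg.
  by rewrite polyC0 polyC1; ring.
elim/poly_ind: F => [|F g IHF].
  have d0 : deriv_inner (0 : {poly {poly k}}) = 0 by rewrite -polyC0 deriv_innerC
    deriv0.
  by rewrite wsubst0 d0 wsubst0 mulr0.
rewrite wsubstD wsubstM wsubstX wsubstC !deriv_innerD !deriv_innerM !deriv_innerC
  deriv_innerX.
rewrite deriv_innerXn inner IHF !mulr0 !addr0 wsubstD wsubstM wsubstX !wsubstC.
by ring.
Qed.

Lemma wsubst_deriv F :
  'X * (wsubst F)^`() = s%:R * ('X^s * wsubst F^`()) + t%:R * (tz * wsubst
    (deriv_inner F)).
Proof.
have XdXn n : 'X * ('X^n)^`() = n%:R * 'X^n :> {poly {poly k}}.
  by rewrite derivXn; case: n => [|n]; rewrite ?mulr0n ?mulr0 ?mul0r // -mulr_natl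
    exprS; ring.
have inner g : 'X * (subst_inner g)^`() = t%:R * (tz * subst_inner g^`()).
  elim/poly_ind: g => [|g c IHg]; first by rewrite deriv0 !subst_inner0 deriv0 !mulr0.
  rewrite subst_innerD subst_innerM subst_innerX subst_innerC derivD !derivM !derivC.
  rewrite derivMXaddC subst_innerD subst_innerM subst_innerX.
  transitivity ('X * (subst_inner g)^`() * tz + subst_inner g * 'X%:P * ('X *
    ('X^t)^`())).
    by ring.
  by rewrite IHg XdXn; ring.
elim/poly_ind: F => [|F g IHF].
  have d0 : deriv_inner (0 : {poly {poly k}}) = 0 by rewrite -polyC0 deriv_innerC
    deriv0.
  by rewrite deriv0 wsubst0 d0 deriv0 !wsubst0 !mulr0 addr0.
rewrite wsubstD wsubstM wsubstX wsubstC derivD !derivM !deriv_innerD !deriv_innerM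
  !deriv_innerC.
rewrite deriv_innerX mulr0 addr0 derivMXaddC !wsubstD !wsubstM wsubstX !wsubstC.
transitivity ('X * (wsubst F)^`() * 'X^s + wsubst F * ('X * ('X^s)^`())
   + 'X * (subst_inner g)^`()); first by ring.
by rewrite IHF XdXn inner; ring.
Qed.

(** For a given power of z, a power of tau comes from at most one monomial,
    since [s] is positive. *)
Lemma coef_wsubst F e j :
  (forall i, e = (s * i + t * j)%N -> (wsubst F)`_e`_j = F`_i`_j) /\
  ((forall i, e <> (s * i + t * j)%N) -> (wsubst F)`_e`_j = 0).
Proof.
have inner g e' j' : (subst_inner g)`_e'`_j' = if e' == (t * j')%N then g`_j' else 0.
  elim/poly_ind: g e' j' => [|g c IHg] e' j';
    first by rewrite subst_inner0 !coef0 if_same.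
  rewrite subst_innerD subst_innerM subst_innerX subst_innerC mulrCA !coefD coefCM.
  rewrite coefMX coefXM (mulrC _ 'X^t) coefXnM !coefC.
  case: j' => [|j'] /=.
    by rewrite muln0 !add0r; case: eqP => //; rewrite coefC.
  have -> : (if e' == 0%N then c%:P else 0)`_j'.+1 = 0.
    by case: ifP => _; rewrite ?coefC ?coef0.
  rewrite !addr0; case: ltnP => [lt_et|le_te].
    by rewrite coef0 ifF //; apply/eqP; rewrite mulnS; lia.
  by rewrite IHg -(eqn_add2l t) subnKC // -mulnS.
elim/poly_ind: F e => [|F g IHF] e.
  by rewrite wsubst0 !coef0; split=> // i _; rewrite !coef0.
have -> : (wsubst (F * 'X + g%:P))`_e`_j =
    (if (e < s)%N then 0 else (wsubst F)`_(e - s)`_j)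
    + (if e == (t * j)%N then g`_j else 0).
  rewrite wsubstD wsubstM wsubstX wsubstC mulrC !coefD coefXnM inner.
  by case: ifP; rewrite ?coef0.
have [IH1 IH2] := IHF (e - s)%N.
split=> [[|i] ei|not_e].
- rewrite coefD coefMX coefC /= add0r ei muln0 add0n eqxx -[RHS]add0r.
  congr (_ + _); case: ltnP => // le_se.
  have [_ IH0] := IHF (t * j - s)%N; apply: IH0 => i.
  by move: s0 le_se; move: (s * i)%N (t * j)%N => u w; lia.
- have nlt : (e < s)%N = false by rewrite ei mulnS; lia.
  have ne : (e == t * j)%N = false.
    by apply/negP => /eqP; move: s0; rewrite ei mulnS; lia.
  rewrite nlt ne addr0 coefD coefMX coefC /= addr0.
  by apply: IH1; rewrite ei mulnS; lia.
- rewrite [in X in _ + X]ifF ?addr0; last first.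
    by apply/eqP => ee; apply: (not_e 0); rewrite ee muln0.
  case: ltnP => // le_se; apply: IH2 => i ei.
  by apply: (not_e i.+1); rewrite mulnS -addnA -ei subnKC.
Qed.

End Substitution.

(** * Absence of Darboux polynomials, from the expansion at infinity *)
(** A power series with nonzero constant term is prime to the variable. *)
Lemma Xn_dvd_cancel (R : idomainType) w (A L G : {poly R}) :
  'X^w * A = L * G -> G`_0 != 0 -> exists mu, L = 'X^w * mu.
Proof.
move=> eqL G0; elim: w A L eqL => [|w IHw] A L eqL.
  by exists L; rewrite mul1r.
have L0 : L`_0 = 0.
  have := congr1 (fun F : {poly R} => F`_0) eqL.
  rewrite coefXnM coef0M => /eqP; rewrite eq_sym mulf_eq0 (negPf G0) orbF.
  by move/eqP.
have eL : L = 'X * drop_poly 1 L.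
  apply/polyP => -[|i]; first by rewrite coefXM.
  by rewrite coefXM coef_drop_poly addn1.
have [|mu emu] := IHw A (drop_poly 1 L).
  apply: (@mulfI _ ('X : {poly R})); first by rewrite polyX_eq0.
  by rewrite mulrA -exprS eqL {1}eL mulrA.
by exists mu; rewrite eL emu mulrA -exprS.
Qed.

Section NoDarboux.
Variable k : fieldType.
Hypothesis char0 : [pchar k] =i pred0.
Variables (a b : k) (r s p q : nat).
Hypotheses (a0 : a != 0) (b0 : b != 0) (s0 : (0 < s)%N) (lt_qp : (q < p)%N).
Implicit Types f lam : {poly {poly k}}.

(** In this section the outer variable is x and the inner one is y; [W'] is
    the reversal of [W]. *)
Local Notation t := (p - q)%N.
Local Notation W := ((a%:P * 'X^s)%:P * 'X^p + b%:P%:P * 'X^q : {poly {poly k}}).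
Local Notation W' := ((a%:P * 'X^s)%:P + b%:P%:P * 'X^t : {poly {poly k}}).

(** The Darboux equation in terms of xi = 1/x. The new term in the cofactor
    is the logarithmic derivative of x^-m along the vector field, times xi^p. *)
Lemma reversed_equation f lam m : size f = m.+1 ->
    ('X^r)%:P * f^`() + W * deriv_inner f = lam * f ->
  (size lam <= p.+1)%N /\
  W' * deriv_inner (revp m f) - 'X^(p.+2) * (('X^r)%:P * (revp m f)^`())
    = (revp p lam - m%:R * ('X^(p.+1) * ('X^r)%:P)) * revp m f.
Proof.
move=> szf eqf.
have f0 : f != 0 by rewrite -size_poly_gt0 szf.
have szW : (size W <= p.+1)%N.
  apply/leq_sizeP => i lt_pi; rewrite coefD !coefCM !coefXn.
  by rewrite gtn_eqF ?(gtn_eqF (ltn_trans lt_qp lt_pi)) // !mulr0 addr0.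
have sz_lam : (size lam <= p.+1)%N.
  have [->|l0] := eqVneq lam 0; first by rewrite size_poly0.
  have szl : (size (lam * f)%R <= p + m.+1)%N.
    rewrite -eqf; apply: leq_trans (size_polyD _ _) _; rewrite geq_max.
    apply/andP; split.
      apply: leq_trans (size_polyMleq _ _) _; rewrite -ltnS.
      have := size_polyC_leq1 ('X^r : {poly k}); have := lt_size_deriv f0.
      rewrite szf; move: (size _) (size _) => u v; lia.
    apply: leq_trans (size_polyMleq _ _) _.
    have := size_deriv_inner f; move: szW; rewrite szf.
    by move: (size _) (size _) => u v; lia.
  move: szl; rewrite size_mul // szf; move: (size lam) => u; lia.
split=> //.
have := congr1 (revp (p + m)) eqf.
rewrite revpD revpCM revp_deriv ?szf // !revpM ?szf ?(leq_trans (size_deriv_inner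
  _)) ?szf //.
have -> : revp p W = W'.
  rewrite revpD !revpCM !revpXn ?subnn ?mulr1 //; exact: ltnW.
move=> eqr; rewrite deriv_inner_revp; apply: (eq_lincomb (c := 1) eqr).
by rewrite !exprS; ring.
Qed.


(** The binomial part of the vector field has weight [om] in tau, and the part
    along xi comes [K] steps later. *)
Local Notation om := (t * s.-1)%N.
Local Notation K := (s * p.+1 + t * r - om)%N.

Lemma exponents : (om + K = s * p.+1 + t * r)%N /\ (0 < K)%N /\ (0 < t)%N.
Proof.
have t0 : (0 < t)%N by rewrite subn_gt0.
have : (om < s * p.+1 + t * r)%N.
  apply: leq_trans (leq_addr _ _); rewrite mulnC.
  apply: leq_ltn_trans (leq_mul (leq_pred s) (leq_subr q p)) _.
  by rewrite mulnS -[X in (X < _)%N]add0n ltn_add2r.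
move: (t * s.-1)%N (s * p.+1 + t * r)%N => u w lt_uw.
by split; [apply: subnKC; apply: ltnW | rewrite subn_gt0].
Qed.

(** The chain rule expresses the derivatives of [F] through those of [P]. *)
Lemma weighted_equation F L :
    W' * deriv_inner F - 'X^(p.+2) * (('X^r)%:P * F^`()) = L * F ->
  forall P, P = wsubst k s t F ->
  'X^om * (s%:R * ((binom a b s)%:P * deriv_inner P)
    - 'X^K * (('X^r)%:P * ('X * P^`() - t%:R * ('X%:P * deriv_inner P))))
  = s%:R * (wsubst k s t L * P).
Proof.
move=> eqF P eP; have [eK _] := exponents.
have := congr1 (wsubst k s t) eqF; have := wsubstXn k s t p.+2.
move: {eqF}'X^(p.+2) => Xp2 eXp2.
rewrite wsubstB !wsubstM wsubstD !wsubstM -eP eXp2 !wsubstXn !wsubstC.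
rewrite subst_innerM !subst_innerC !subst_innerXn.
have dP : 'X * P^`() - t%:R * ('X%:P * deriv_inner P) = s%:R * ('X^s * wsubst k s t
  F^`()).
  by rewrite eP wsubst_deriv wsubst_deriv_inner; ring.
rewrite dP => <-; rewrite [in LHS]eP wsubst_deriv_inner.
have e1 : 'X^(s * p.+2) = 'X^(s * p.+1) * 'X^s :> {poly {poly k}}.
  by rewrite -exprD mulnS addnC.
have e2 : 'X^om * 'X^K = 'X^(s * p.+1) * 'X^(t * r) :> {poly {poly k}}.
  by rewrite -!exprD eK.
have e3 : 'X^(t * s) = 'X^om * 'X^t :> {poly {poly k}}.
  by rewrite -exprD -mulnSr prednK.
rewrite (mulnC s t) e1 e3 /binom polyCD.
set D := wsubst k s t (deriv_inner F); set D' := wsubst k s t F^`().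
transitivity ('X^om * (s%:R * (((a%:P * 'X^s)%:P + b%:P%:P) * ('X^t * D)))
  - ('X^om * 'X^K) * (('X^r)%:P * (s%:R * ('X^s * D')))); first by ring.
by rewrite e2 polyCM; ring.
Qed.

(** The size condition bounds the y-degree of the cofactor; it makes the
    degree bound of [local_index] available. *)
Lemma no_darboux f lam : f != 0 ->
    ('X^r)%:P * f^`() + W * deriv_inner f = lam * f ->
    (forall i, (size (lam`_i)%R <= maxn r s)%N) ->
  exists2 c : k, c != 0 & f = c%:P%:P.
Proof.
move=> f0 eqf sz_lam.
have [m szf] : exists m, size f = m.+1.
  by exists (size f).-1; rewrite prednK // size_poly_gt0.
have [szl eqF] := reversed_equation szf eqf.
have [eK [K0 t0]] := exponents.
set F := revp m f in eqF; set L := (X in X * F) in eqF.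
have coefL i j : L`_i`_j = (if (i <= p)%N then lam`_(p - i)`_j else 0)
    - m%:R * ((i == p.+1) && (j == r))%:R.
  rewrite /L coefB coef_revp mulrA -mulrA -polyC_natr coefCM coefMC coefXn.
  rewrite coefB -polyC_natr coefCM; congr (_ - _ * _).
    by case: ifP; rewrite ?coef0.
  by case: (i == p.+1); rewrite ?mul1r ?mul0r ?coefXn ?coef0.
have coefF i j : F`_i`_j = if (i <= m)%N then f`_(m - i)`_j else 0.
  by rewrite coef_revp; case: ifP; rewrite ?coef0.
have F_0 : F`_0 = lead_coef f by rewrite coef_revp subn0 lead_coefE szf.
have lead0 : F`_0 != 0 by rewrite F_0 lead_coef_eq0.
have [P eP0] : exists P, P = wsubst k s t F by exists (wsubst k s t F).
have coefP i j : P`_(s * i + t * j)`_j = F`_i`_j.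
  by rewrite eP0; have [h _] := coef_wsubst t s0 F (s * i + t * j) j; apply: h.
have P0 : P != 0.
  apply: contraNneq lead0 => P0; apply/eqP/polyP => j.
  by rewrite -coefP P0 !coef0.
have [v [G [eP G0]]] := Xn_factor P0.
have pdeP := weighted_equation eqF eP0.
have XN0 n : 'X^n != 0 :> {poly {poly k}} by rewrite monic_neq0 ?monicXn.
have eqG : 'X^om * (s%:R * ((binom a b s)%:P * deriv_inner G)
    - 'X^K * (('X^r)%:P * ('X * G^`() + v%:R * G - t%:R * ('X%:P * deriv_inner G))))
  = s%:R * wsubst k s t L * G.
  apply: (mulfI (XN0 v)).
  have dXv : 'X * ('X^v)^`() = v%:R * 'X^v :> {poly {poly k}}.
    rewrite derivXn; case: (v) => [|n]; first by rewrite mulr0n mulr0 mul0r.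
    by rewrite -mulr_natl exprS; ring.
  have dP : 'X * (('X^v)^`() * G + 'X^v * G^`()) = 'X^v * ('X * G^`() + v%:R * G).
    by rewrite mulrDr mulrA dXv; ring.
  move: pdeP; rewrite eP deriv_innerM deriv_innerXn derivM dP mul0r add0r => pdeP.
  by apply: (eq_lincomb (c := 1) pdeP); ring.
have [mu eL] : exists mu, wsubst k s t L = 'X^om * mu.
  have [mu emu] := Xn_dvd_cancel eqG G0.
  exists ((s%:R^-1)%:P%:P * mu); rewrite mulrCA -emu mulrA.
  have -> : s%:R = (s%:R : k)%:P%:P :> {poly {poly k}} by rewrite !polyC_natr.
  have sV : s%:R^-1 * s%:R = 1 :> k by rewrite mulVf ?natr_neq0.
  by rewrite -(polyCM (s%:R^-1)%:P) -(polyCM s%:R^-1) sV mul1r.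
have coef_mu e j : mu`_e`_j = (wsubst k s t L)`_(om + e)`_j.
  by rewrite eL coefXnM ltnNge leq_addr /= addKn.
have {}eqG : s%:R * ((binom a b s)%:P * deriv_inner G) - 'X^K * (('X^r)%:P
    * ('X * G^`() + v%:R * G - t%:R * ('X%:P * deriv_inner G))) = s%:R * (mu * G).
  by apply: (mulfI (XN0 om)); rewrite eqG eL; ring.
(* A monomial xi^i y^j of [L] that contributes at order [om + K] satisfies
   s i + t j = s (p + 1) + t r. For j = r this is i = p + 1, and the reversal
   of [lam] stops at xi^p: only the correction term is left. For j < r the
   exponent i is even larger. *)
have mu_r : mu`_K`_r = - m%:R.
  rewrite coef_mu eK; have [h _] := coef_wsubst t s0 L (s * p.+1 + t * r) r.
  by rewrite (h p.+1) // coefL ltnn !eqxx sub0r mulr1.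
have mu_low j : (j < r)%N -> mu`_K`_j = 0.
  move=> lt_jr; rewrite coef_mu eK.
  have [L1 L2] := coef_wsubst t s0 L (s * p.+1 + t * r) j.
  case: (classic (exists i, s * p.+1 + t * r = s * i + t * j)%N) => [[i ei]|no_i].
    rewrite (L1 i) // coefL (ltn_eqF lt_jr) andbF mulr0 subr0 ifN // -ltnNge.
    have lt_t : (t * j < t * r)%N by rewrite ltn_pmul2l.
    have : (s * p.+1 < s * i)%N by rewrite -(ltn_add2r (t * j)) -ei ltn_add2l.
    by rewrite ltn_pmul2l //; apply: ltnW.
  by apply: L2 => i ei; apply: no_i; exists i.
have sz_mu : (size (mu`_K)%R <= maxn r.+1 s)%N.
  apply/leq_sizeP => j; rewrite geq_max => /andP[lt_rj le_sj].
  rewrite coef_mu eK.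
  have [L1 L2] := coef_wsubst t s0 L (s * p.+1 + t * r) j.
  case: (classic (exists i, s * p.+1 + t * r = s * i + t * j)%N) => [[i ei]|no_i].
    rewrite (L1 i) // coefL (gtn_eqF lt_rj) andbF mulr0 subr0; case: ifP => // _.
    apply: nth_default; apply: leq_trans (sz_lam _) _.
    by rewrite geq_max le_sj ltnW.
  by apply: L2 => i ei; apply: no_i; exists i.
have [G00 lead_mu idx] := local_index char0 a0 b0 s0 G0 K0 eqG sz_mu mu_low mu_r.
have P_v0 : P`_v`_0 != 0 by rewrite eP coefXnM ltnn subnn.
(* [G] does not vanish at tau = z = 0, so a pure power of xi reaches the
   lowest weight. *)
have [n ev le_nm] : exists2 n, v = (s * n)%N & (n <= m)%N.
  have [F1 F2] := coef_wsubst t s0 F v 0.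
  case: (classic (exists i, v = s * i + t * 0)%N) => [[i ei]|no_i].
    exists i; first by rewrite ei muln0 addn0.
    move: P_v0; rewrite eP0 (F1 i) // coefF; case: ifP => //.
    by rewrite eqxx.
  move: P_v0; rewrite eP0 F2 ?eqxx // => i ei; apply: no_i.
  by exists i.
have [d0 emn] : (size (G`_0)%R).-1 = 0%N /\ n = m.
  have : (t * r.+1 * (size (G`_0)%R).-1 + s * (s * m) = s * (s * n))%N.
    apply: (natr_inj char0); rewrite natrD idx -ev !natrM; ring.
  move=> eqn; have le_ss : (s * (s * n) <= s * (s * m))%N by rewrite !leq_pmul2l.
  have /eqP : (t * r.+1 * (size (G`_0)%R).-1 = 0)%N.
    move: eqn le_ss; move: (t * _ * _)%N (s * (s * m))%N (s * (s * n))%N => u w x eqn.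
    by rewrite -eqn -[X in (_ <= X)%N]add0n leq_add2r leqn0 => /eqP.
  rewrite !muln_eq0 (gtn_eqF t0) /= => /eqP d0; split=> //.
  move: eqn; rewrite d0 muln0 add0n => /eqP.
  by rewrite !eqn_pmul2l // => /eqP.
(* [L`_0] is the coefficient of x^p in [lam]; without y^(s-1) it cannot make
   the leading coefficient [F`_0] of [f] depend on y. *)
have L_0 : L`_0`_s.-1 = 0.
  have [L1 _] := coef_wsubst t s0 L om s.-1.
  by rewrite -(L1 0) ?muln0 // -[om in LHS]addn0 -coef_mu lead_mu d0 mulr0.
have eq_lead : a%:P * 'X^s * (F`_0)^`() = L`_0 * F`_0.
  have := congr1 (fun H : {poly {poly k}} => H`_0) eqF.
  rewrite coefB coefXnM subr0 !coef0M coef_deriv_inner coefD coefC coefCM coefXn.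
  by rewrite (ltn_eqF t0) mulr0 addr0.
have dF0 : (F`_0)^`() = 0.
  apply/eqP; apply: contraTT isT => dF0.
  have Xs0 : a%:P * 'X^s != 0 by rewrite mulf_neq0 ?polyC_eq0 // monic_neq0 ?monicXn.
  have L0 : L`_0 != 0.
    by apply: contraNneq (mulf_neq0 Xs0 dF0) => L0; rewrite eq_lead L0 mul0r.
  have := congr1 (fun H : {poly k} => size H) eq_lead.
  have szF0 : (1 < size (F`_0)%R)%N.
    by rewrite ltnNge; apply: contra dF0 => /size1_polyC ->; rewrite derivC.
  have szX : size (a%:P * 'X^s)%R = s.+1 by rewrite mul_polyC size_scale ?size_polyXn.
  rewrite (size_mul Xs0 dF0) (size_mul L0 lead0) szX.
  rewrite (size_deriv0 char0) => eqsz.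
  have szL : size L`_0 = s.
    by move: eqsz szF0; case: (size _) => [|[|u]] //= ; rewrite !addnS => -[/addIn].
  by move: L0; rewrite -lead_coef_eq0 lead_coefE szL L_0 eqxx.
have szF0 : (size (F`_0)%R <= 1)%N.
  by have := size_deriv0 char0 F`_0; rewrite dF0 size_poly0; case: (size _) => [|[]].
have m0 : m = 0%N.
  have v0 : v = 0%N.
    apply/eqP; rewrite -leqn0 leqNgt; apply/negP => v_gt0.
    have := coefP 0 0; rewrite !muln0 eP coefXnM v_gt0 coef0 => F00.
    by move: lead0; rewrite (size1_polyC szF0) -F00 polyC0 eqxx.
  by apply/eqP; move/eqP: ev; rewrite v0 emn eq_sym muln_eq0 gtn_eqF.
have ef : f = (lead_coef f)%:P by rewrite lead_coefE szf m0; apply: size1_polyC;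
  rewrite szf m0.
exists F`_0`_0.
  by move: lead0; rewrite {1}(size1_polyC szF0) polyC_eq0.
by rewrite -(size1_polyC szF0) F_0.
Qed.

End NoDarboux.

(** * Darboux polynomials of the binomial vector fields *)
Section Darboux.
Variable k : fieldType.
Hypothesis char0 : [pchar k] =i pred0.
Implicit Types (f lam Q : {poly {poly k}}).

Definition mono (c : k) i j : {poly {poly k}} := (c%:P * 'X^i)%:P * 'X^j.

(** The derivation y^r d/dx + Q d/dy; from here on the outer variable is y
    and the inner one is x. *)
Definition bider r Q f : {poly {poly k}} := 'X^r * deriv_inner f + Q * f^`().

Lemma size_mono_const a p s b q : (0 < s)%N ->
  (size (mono a p s + mono b q 0)%R <= s.+1)%N.
Proof.
move=> s0; apply/leq_sizeP => i lt_si; rewrite coefD !coefCM !coefXn.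
by rewrite gtn_eqF ?(gtn_eqF (ltn_trans s0 lt_si)) // !mulr0 addr0.
Qed.

(** Degrees in y suffice, except that for r >= s they allow a coefficient of
    y^r in [lam]: then the leading coefficient of [f] would divide its own
    derivative. *)
Lemma size_cofactor r s Q f lam : f != 0 -> (0 < s)%N -> (size Q <= s.+1)%N ->
  bider r Q f = lam * f -> (size lam <= maxn r s)%N.
Proof.
move=> f0 s0 szQ eqf.
have [->|l0] := eqVneq lam 0; first by rewrite size_poly0.
have szXd : (size ('X^r * deriv_inner f)%R <= r + size f)%N.
  apply: leq_trans (size_polyMleq _ _) _; rewrite size_polyXn addSn /=.
  by rewrite leq_add2l size_deriv_inner.
have [n szf] : exists n, size f = n.+1.
  by exists (size f).-1; rewrite prednK // size_poly_gt0.
have szQd : (size (Q * f^`())%R <= s + n)%N.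
  apply: leq_trans (size_polyMleq _ _) _; have := lt_size_deriv f0.
  by move: szQ; rewrite szf; move: (size _) (size _) => u w; lia.
have szlf : (size lam + n <= maxn r.+1 s + n)%N.
  have := size_polyD ('X^r * deriv_inner f) (Q * f^`()).
  rewrite -/(bider r Q f) eqf size_mul // szf addnS /= => /leq_trans; apply.
  rewrite geq_max (leq_trans szXd) ?(leq_trans szQd) // ?leq_add2r ?leq_maxr //.
  by rewrite szf addnS -addSn leq_add2r leq_maxl.
rewrite leq_add2r in szlf.
have [lt_rs|le_sr] := ltnP r s; first by rewrite (maxn_idPr lt_rs) in szlf.
rewrite (maxn_idPl (leqW le_sr)) in szlf.
rewrite leqNgt; apply/negP => lt_r.
have szl : size lam = r.+1 by apply/eqP; rewrite eqn_leq szlf lt_r.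
have elead : (f`_n)^`() = lam`_r * f`_n.
  have := lead_coefM lam f; rewrite !lead_coefE size_mul // szl szf -eqf /=.
  rewrite addnS /= coefD coefXnM ltnNge leq_addr /= addKn coef_deriv_inner.
  have -> : (Q * f^`())`_(r + n) = 0.
    by apply: nth_default; apply: leq_trans szQd _; rewrite leq_add2r.
  by rewrite addr0.
have lead0 : f`_n != 0 by have := f0; rewrite -lead_coef_eq0 lead_coefE szf.
have lam0 : lam`_r != 0 by have := l0; rewrite -lead_coef_eq0 lead_coefE szl.
have : f`_n %| (f`_n)^`() by rewrite elead dvdp_mull.
rewrite (dvdp_deriv char0) => /size1_polyC e; move/eqP: elead.
by rewrite {1}e derivC eq_sym mulf_eq0 (negPf lead0) (negPf lam0).
Qed.

Lemma swapXYXn n : swapXY 'X^n = ('X^n)%:P :> {poly {poly k}}.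
Proof. by rewrite rmorphXn /= swapXY_X polyC_exp. Qed.

Lemma swapXY_mono c i j :
  swapXY (mono c i j) = c%:P%:P * 'X^i * ('X^j)%:P :> {poly {poly k}}.
Proof.
have mapM (g h : {poly k}) : (g * h)^:P = g^:P * h^:P by exact: rmorphM.
by rewrite rmorphM /= swapXYXn swapXY_polyC mapM map_polyC map_polyXn.
Qed.

Lemma darboux_const_lt a b p q r s f lam : a != 0 -> b != 0 -> (0 < s)%N ->
    (q < p)%N -> f != 0 ->
    bider r (mono a p s + mono b q 0) f = lam * f ->
  exists2 c : k, c != 0 & f = c%:P%:P.
Proof.
move=> a0 b0 s0 lt_qp f0 eqf.
have szl := size_cofactor f0 s0 (size_mono_const a p b q s0) eqf.
have [||i|c c0 ef] := no_darboux (r := r) char0 a0 b0 s0 lt_qp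
  (f := swapXY f) (lam := swapXY lam).
- by rewrite swapXY_eq0.
- rewrite -rmorphM -eqf rmorphD !rmorphM rmorphD /= !swapXY_mono swapXYXn.
  by rewrite /deriv_inner !swapXYK expr0 ?polyC1 ?mulr1 ?polyCM; ring.
- apply/leq_sizeP => j le_j; rewrite coef_swapXY.
  have -> : lam`_j = 0 by apply: nth_default; apply: leq_trans szl le_j.
  by rewrite coef0.
exists c => //; rewrite -[f]swapXYK ef swapXY_polyC map_polyC //.
Qed.

(** In the coordinate u = 1/y the vector field, multiplied by u^(s-2), is
    u^(s-2) d/dx - (b x^q u^s + a x^p) d/du, for which the exponents are in
    the order required by [darboux_const_lt]. Hence the reversal of [f] is
    constant and [f] is a multiple of a power of y, which is not Darboux. *)
Lemma darboux_const_gt a b p q s f lam : a != 0 -> b != 0 -> (1 < s)%N ->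
    (p < q)%N -> f != 0 ->
    bider 0 (mono a p s + mono b q 0) f = lam * f ->
  (size f <= 1)%N.
Proof.
move=> a0 b0 s1 lt_pq f0 eqf; rewrite leqNgt; apply/negP => szf1.
have [n szf] : exists n, size f = n.+2.
  by exists (size f).-2; case: (size f) szf1 => [|[]].
case: s s1 eqf => [//|[//|s]] _ eqf.
have szl : (size lam <= s.+2)%N.
  have := size_cofactor f0 _ (size_mono_const a p b q _) eqf.
  by rewrite max0n; apply.
pose F := revp n.+1 f.
have szf' : (size f <= n.+2)%N by rewrite szf.
have F_0 : F`_0 = lead_coef f by rewrite coef_revp subn0 lead_coefE szf.
have F_0n0 : F`_0 != 0 by rewrite F_0 lead_coef_eq0.
have F0 : F != 0 by apply: contraNneq F_0n0 => ->; rewrite coef0.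
pose A := a%:P * 'X^p; pose B := b%:P * 'X^q.
pose E := n.+1%:R * F - 'X * F^`().
have sz_df : (size f^`() <= n.+1)%N.
  by have := lt_size_deriv f0; rewrite szf ltnS.
have ef' : revp (s.+1 + n.+1) f^`() = 'X^(s.+2) * E.
  exact: revp_deriv.
have eqr : 'X^(s.+1) * deriv_inner F + A%:P * E + B%:P * ('X^(s.+2) * E)
    = revp s.+1 lam * F.
  have := congr1 (revp (s.+1 + n.+1)) eqf.
  rewrite [in X in _ = X]revpM ?szf // => <-.
  have -> : bider 0 (mono a p s.+2 + mono b q 0) f =
      deriv_inner f + A%:P * ('X^(s.+1) * ('X * f^`())) + B%:P * f^`().
    by rewrite /bider /mono expr0 -/A -/B (exprSr _ s.+1); ring.
  rewrite !revpD !revpCM revpXnM; last first.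
    by apply: leq_trans (size_polyMleq _ _) _; rewrite size_polyX.
  rewrite revp_euler // -/F -/E revp_shift ?(leq_trans (size_deriv_inner _)) //.
  by rewrite -deriv_inner_revp -/F ef'.
(* This cancels the pole at u = 0 of the logarithmic derivative of y^(n+1). *)
have l_0 : (revp s.+1 lam)`_0 = n.+1%:R * A.
  apply: (mulIf F_0n0); have := congr1 (fun H : {poly {poly k}} => H`_0) eqr.
  rewrite coef0M => <-; rewrite !coefD !coefCM !coefXnM /= mulr0 addr0 add0r.
  by rewrite coefB coefXM -polyC_natr coefCM subr0; ring.
pose l2 := drop_poly 1 (revp s.+1 lam).
have el : revp s.+1 lam = (n.+1%:R * A)%:P + 'X * l2.
  apply/polyP => -[|i]; first by rewrite coefD coefC coefXM addr0.
  by rewrite coefD coefC coefXM add0r coef_drop_poly addn1.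
have eqF : bider s (mono (- b) q s.+2 + mono (- a) p 0) F
    = (l2 - n.+1%:R * B%:P * 'X^(s.+1)) * F.
  have X0 : 'X != 0 :> {poly {poly k}} by rewrite polyX_eq0.
  have eC : (n.+1%:R * A)%:P = n.+1%:R * A%:P by rewrite polyCM polyC_natr.
  apply: (mulfI X0); move: eqr; rewrite el /E eC => eqr.
  apply: (eq_lincomb (c := 1) eqr).
  rewrite /bider /mono expr0 !polyCN !mulNr !polyCN -/A -/B (exprS _ s).
  by rewrite (exprS _ s.+1) (exprS _ s); ring.
have [|||c c0 eF] := darboux_const_lt (r := s) _ _ _ lt_pq F0 eqF;
  rewrite ?oppr_eq0 //.
have ef : f = c%:P%:P * 'X^(n.+1).
  apply/polyP => i; rewrite coefCM coefXn.
  have := coef_revp n.+1 f (n.+1 - i); rewrite -/F eF coefC leq_subr.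
  case: (ltngtP i n.+1) => [lt_in|gt_in|->].
  - by rewrite subn_eq0 leqNgt lt_in subKn 1?ltnW // mulr0 => <-.
  - by move=> _; rewrite mulr0 nth_default // szf.
  - by rewrite subnn eqxx subn0 mulr1.
have : (mono a p s.+2 + mono b q 0) * n.+1%:R = lam * 'X.
  have Xn0 : c%:P%:P * 'X^n != 0.
    by apply: mulf_neq0; [rewrite !polyC_eq0 | rewrite monic_neq0 ?monicXn].
  apply: (mulIf Xn0); move: eqf; rewrite ef /bider deriv_innerM deriv_innerC
    deriv_innerXn.
  rewrite derivC derivM derivC derivXn -mulr_natl /= (exprS _ n) => eqf.
  by apply: (eq_lincomb (c := 1) eqf); ring.
have Bn0 : b%:P * 'X^q != 0.
  by apply: mulf_neq0; [rewrite polyC_eq0 | rewrite monic_neq0 ?monicXn].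
move/(congr1 (fun H : {poly {poly k}} => H`_0)).
rewrite coefMX -polyC_natr coefMC coefD !coefCM !coefXn /= mulr0 add0r mulr1.
by move/eqP; rewrite mulf_eq0 (negPf Bn0) -polyC_natr polyC_eq0 (negPf (natr_neq0
  char0 _)).
Qed.

End Darboux.

(** * The case that is linear in y *)
Section LinearODE.
Variable k : fieldType.
Hypothesis char0 : [pchar k] =i pred0.

(** The top degree of [h] is q - p. From there on down, the equation links
    coefficients p + 1 apart, so all those are nonzero. They must end at the
    constant term: otherwise the derivative of the last one has nothing to
    cancel with. *)
Lemma linear_ode_dvdn (a b : k) p q (h : {poly k}) : a != 0 -> b != 0 ->
    (p < q)%N -> h^`() = a%:P * 'X^p * h + b%:P * 'X^q ->
  (p.+1 %| q - p)%N.
Proof.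
move=> a0 b0 lt_pq eqh.
have coefh i : h`_i.+1 *+ i.+1 =
    (if (i < p)%N then 0 else a * h`_(i - p)) + b * (i == q)%:R.
  rewrite -coef_deriv eqh coefD coefCM coefXn -mulrA coefCM coefXnM.
  by case: ifP; rewrite ?mulr0.
have h0 : h != 0.
  apply: contraNneq b0 => h0; have := coefh q.
  by rewrite h0 !coef0 mul0rn mulr0 if_same add0r eqxx mulr1 => <-.
have [D eDsz] : exists D, size h = D.+1.
  by exists (size h).-1; rewrite prednK ?size_poly_gt0.
have hD : h`_D != 0 by have := h0; rewrite -lead_coef_eq0 lead_coefE eDsz.
have h_gt i : (D < i)%N -> h`_i = 0.
  by move=> ltDi; apply: nth_default; rewrite eDsz.
have eD : (D + p)%N = q.
  apply/eqP; have := coefh (D + p)%N.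
  rewrite h_gt ?ltnS ?leq_addr // mul0rn ltnNge leq_addl /= addnK.
  case: eqP => // _ /esym/eqP.
  by rewrite mulr0 addr0 mulf_eq0 (negPf a0) (negPf hD).
have hj j : (j * p.+1 <= D)%N -> h`_(D - j * p.+1) != 0.
  elim: j => [|j IHj] le_j; first by rewrite mul0n subn0.
  have {}IHj := IHj (leq_trans (leq_mul (leqnSn _) (leqnn _)) le_j).
  have := coefh (D - j.+1 * p.+1 + p)%N.
  rewrite ltnNge leq_addl /= addnK.
  have -> : (D - j.+1 * p.+1 + p).+1 = (D - j * p.+1)%N.
    by move: le_j; rewrite mulSn; move: (j * p.+1)%N => u; lia.
  rewrite -eD eqn_add2r.
  rewrite ltn_eqF; last by move: le_j; rewrite mulSn; move: (j * p.+1)%N => u; lia.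
  rewrite mulr0 addr0 => e; apply: contraNneq IHj => e0; move/eqP: e.
  rewrite e0 mulr0 -mulr_natr mulf_eq0 => /orP[/eqP //|].
  by rewrite (negPf (natr_neq0 char0 _)) //;
    move: le_j; rewrite mulSn; move: (j * p.+1)%N => u; lia.
rewrite -eD addnK; have := hj _ (leq_trunc_div D p.+1).
have eDv : (D - D %/ p.+1 * p.+1 = D %% p.+1)%N by rewrite {1}(divn_eq D p.+1) addKn.
rewrite eDv /dvdn; case ev: (D %% p.+1)%N => [//|v] hv.
have lt_vp : (v < p)%N by rewrite -ltnS -ev ltn_mod.
have /eqP := coefh v; rewrite lt_vp add0r ltn_eqF ?(ltn_trans lt_vp) //.
by rewrite mulr0 -mulr_natr mulf_eq0 (negPf hv) (negPf (natr_neq0 char0 _)).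
Qed.

End LinearODE.

Section DarbouxLinear.
Variable k : fieldType.
Hypothesis char0 : [pchar k] =i pred0.

(** The leading coefficient of [f] divides its derivative, so it is constant;
    the next coefficient, suitably scaled, then solves
    h' = a x^p h + b x^q. *)
Lemma darboux_const_linear (a b : k) p q (f lam : {poly {poly k}}) :
    a != 0 -> b != 0 -> (p < q)%N -> ~~ (p.+1 %| q - p)%N -> f != 0 ->
    bider 0 (mono a p 1 + mono b q 0) f = lam * f ->
  (size f <= 1)%N.
Proof.
move=> a0 b0 lt_pq ndv f0 eqf; rewrite leqNgt; apply/negP => szf1.
have [n szf] : exists n, size f = n.+2.
  by exists (size f).-2; case: (size f) szf1 => [|[]].
have szl : (size lam <= 1)%N.
  by have := size_cofactor char0 f0 _ (size_mono_const a p b q _) eqf; apply.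
have coef_eq i : (f`_i)^`() + a%:P * 'X^p * (f`_i *+ i)
    + b%:P * 'X^q * (f`_i.+1 *+ i.+1) = lam`_0 * f`_i.
  have := congr1 (fun H : {poly {poly k}} => H`_i) eqf.
  rewrite [lam in X in _ = X -> _](size1_polyC szl) coefCM => <-.
  have -> : bider 0 (mono a p 1 + mono b q 0) f = deriv_inner f
      + (a%:P * 'X^p)%:P * ('X * f^`()) + (b%:P * 'X^q)%:P * f^`().
    by rewrite /bider /mono expr0 expr1; ring.
  by rewrite !coefD !coefCM coef_deriv_inner coef_XMderiv coef_deriv.
have lead0 : f`_n.+1 != 0 by have := f0; rewrite -lead_coef_eq0 lead_coefE szf.
have := coef_eq n.+1; rewrite [f`_n.+2]nth_default ?szf // mul0rn mulr0 addr0.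
move=> eqn; have : f`_n.+1 %| (f`_n.+1)^`().
  have -> : (f`_n.+1)^`() = f`_n.+1 * (lam`_0 - a%:P * 'X^p * n.+1%:R).
    by rewrite mulrBr [_ * lam`_0]mulrC -eqn -mulr_natl; ring.
  exact: dvdp_mulr.
rewrite (dvdp_deriv char0) => /size1_polyC; set c := _`_0 => ec.
have c0 : c != 0 by move: lead0; rewrite ec polyC_eq0.
have el : lam`_0 = a%:P * 'X^p * n.+1%:R.
  by apply: (mulIf lead0); rewrite -eqn ec derivC add0r -mulr_natl; ring.
have n0 := natr_neq0 char0 (ltn0Sn n).
have [u eu] : exists u : k, u%:P * (n.+1%:R * c%:P) = 1.
  exists (n.+1%:R * c)^-1.
  by rewrite -polyC_natr -!polyCM mulVf ?polyC1 // mulf_neq0.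
have := coef_eq n; rewrite ec el => eqn1.
suff : (p.+1 %| q - p)%N by apply/negP.
apply: (linear_ode_dvdn char0 (h := (- u)%:P * f`_n) a0 b0 lt_pq).
rewrite derivM derivC mul0r add0r polyCN.
transitivity (- u%:P * (f`_n)^`()
   + (1 - u%:P * (n.+1%:R * c%:P)) * (b%:P * 'X^q)).
  by rewrite eu subrr mul0r addr0.
move: eqn1; rewrite -[f`_n *+ n]mulr_natl -[c%:P *+ _]mulr_natl -natr1.
move: (f`_n) (f`_n)^`() (b%:P * 'X^q) (a%:P * 'X^p) => F F' B A eqn1.
by apply: (eq_lincomb (c := - u%:P) eqn1); ring.
Qed.

Lemma darboux_size1 (a b : k) r s p q (f lam : {poly {poly k}}) :
    a != 0 -> b != 0 -> (0 < s)%N ->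
    [\/ (q < p)%N, [/\ r = 0%N, (p < q)%N & (1 < s)%N] |
       [/\ r = 0%N, s = 1%N, (p < q)%N & ~~ (p.+1 %| q - p)%N]] ->
    f != 0 -> bider r (mono a p s + mono b q 0) f = lam * f ->
  (size f <= 1)%N.
Proof.
move=> a0 b0 s0 [lt_qp|[-> lt_pq s1]|[-> -> lt_pq ndv]] f0 eqf.
- by have [c _ ->] := darboux_const_lt char0 a0 b0 s0 lt_qp f0 eqf;
    apply: size_polyC_leq1.
- exact: (darboux_const_gt char0 a0 b0 s1 lt_pq f0 eqf).
- exact: (darboux_const_linear a0 b0 lt_pq ndv f0 eqf).
Qed.

End DarbouxLinear.

(** * Differential ideals and contents *)
Section DifferentialIdeals.
Variables (A : comNzRingType) (d : A -> A) (I : A -> Prop).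
Hypotheses (der_d : derivation d) (ideal_I : ideal I) (diff_I : differential d I).

Lemma derivation1 : d 1 = 0.
Proof.
have [_ dM] := der_d; apply: (@addrI _ (d 1)); rewrite addr0.
by have := dM 1 1; rewrite !mul1r => <-.
Qed.

Lemma derivation_exp w n : w * d (w ^+ n) = n%:R * w ^+ n * d w.
Proof.
have [_ dM] := der_d; elim: n => [|n IHn]; first by rewrite derivation1 !mul0r mulr0.
by rewrite exprS dM mulrDr IHn -natr1; ring.
Qed.

Lemma idealB a b : I a -> I b -> I (a - b).
Proof.
have [_ ID IM] := ideal_I => Ia Ib; apply: ID => //.
by rewrite -mulN1r; apply: IM.
Qed.

Lemma idealMr a b : I a -> I (a * b).
Proof. by have [_ _ IM] := ideal_I => Ia; rewrite mulrC; apply: IM. Qed.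

(** Differentiating [e g * w ^+ N] and multiplying by [w] replaces [g] by its
    derivative, modulo the ideal, at the cost of two more factors [w]. After
    deg g steps only a nonzero constant is left of [g]. *)
Lemma differential_power (k : fieldType) (e : {poly k} -> A) (w : A) :
    [pchar k] =i pred0 ->
    (forall g, d (e g) = w * e g^`()) ->
    (forall c, c != 0 -> exists u, u * e c%:P = 1) ->
  forall g, g != 0 -> I (e g) -> exists N, I (w ^+ N).
Proof.
move=> char0 de unit_e g g0 Ieg.
have {Ieg} : I (e g * w ^+ 0) by rewrite mulr1.
have [_ ID IM] := ideal_I; have [_ dM] := der_d.
move: {2}(size g) (leqnn (size g)) 0%N => n; elim: n g g0 => [|n IHn] g g0 szg N Ieg.
  by move: szg; rewrite leqNgt size_poly_gt0 g0.
have [sz1|sz1] := leqP (size g) 1.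
  exists N; have [|u eu] := unit_e g`_0; first by rewrite -polyC_eq0 -size1_polyC.
  by rewrite -[w ^+ N]mul1r -eu -size1_polyC // -mulrA; apply: IM.
have g'0 : g^`() != 0 by rewrite -size_poly_gt0 (size_deriv0 char0) -subn1 subn_gt0.
apply: (IHn g^`() g'0 _ N.+2).
  by rewrite (size_deriv0 char0) -subn1 leq_subLR.
have -> : e g^`() * w ^+ N.+2 = w * d (e g * w ^+ N) - N%:R * d w * (e g * w ^+ N).
  rewrite dM mulrDr [w * (e g * _)]mulrCA derivation_exp de !exprS; ring.
by apply: idealB; apply: IM => //; apply: diff_I.
Qed.

Lemma comaximal_powers u v al be m n :
  al * u + be * v = 1 -> I (u ^+ m) -> I (v ^+ n) -> I 1.
Proof.
move=> e1 Iu Iv; have [_ ID IM] := ideal_I.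
suff H l i j : (m - i + (n - j) <= l)%N -> I (u ^+ i * v ^+ j).
  by have := H _ 0 0 (leqnn _); rewrite !expr0 mulr1.
elim: l i j => [|l IHl] i j le_l.
  have le_mi : (m <= i)%N by lia.
  by rewrite -(subnKC le_mi) exprD -mulrA; apply: idealMr.
have [le_mi|lt_im] := leqP m i.
  by rewrite -(subnKC le_mi) exprD -mulrA; apply: idealMr.
have [le_nj|lt_jn] := leqP n j.
  by rewrite -(subnKC le_nj) exprD mulrCA; apply: idealMr.
have -> : u ^+ i * v ^+ j = al * (u ^+ i.+1 * v ^+ j) + be * (u ^+ i * v ^+ j.+1).
  by rewrite -[LHS]mul1r -e1 !exprS; ring.
by apply: ID; apply: IM; apply: IHl; lia.
Qed.

End DifferentialIdeals.

Lemma ex_min_nat (P : nat -> Prop) : (exists n, P n) ->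
  exists n, P n /\ forall m, P m -> (n <= m)%N.
Proof.
move=> [n Pn]; elim/ltn_ind: n Pn => n IHn Pn.
case: (classic (exists2 m, (m < n)%N & P m)) => [[m lt_mn Pm]|no_m].
  exact: IHn lt_mn Pm.
exists n; split=> // m Pm; rewrite leqNgt; apply/negP => lt_mn.
by apply: no_m; exists m.
Qed.

Section Gauss.
Variable k : fieldType.
Implicit Types (c pi : {poly k}) (f g h q : {poly {poly k}}).

Lemma irreducible_divisor c : (1 < size c)%N ->
  exists2 pi, irreducible_poly pi & pi %| c.
Proof.
have [n eqn] : exists n, size c = n by exists (size c).
elim/ltn_ind: n c eqn => n IHn c szc; rewrite szc => n1.
case: (classic (irreducible_poly c)) => [irr|nirr]; first by exists c.
have c0 : c != 0 by rewrite -size_poly_gt0 szc ltnW.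
have [q [szq dvq neq]] : exists q : {poly k}, [/\ size q != 1%N, q %| c & ~~ (q %= c)].
  apply: NNPP => no_q; apply: nirr; split; first by rewrite szc.
  move=> q szq dvq; apply/negPn/negP => neq; apply: no_q; by exists q.
have q0 : q != 0 by apply: contraTneq dvq => ->; rewrite dvd0p.
have lt_q : (size q < n)%N.
  by rewrite -szc ltn_neqAle dvdp_leq // andbT -(dvdp_size_eqp dvq) in neq *.
have [|pi irr dvpi] := IHn _ lt_q q (erefl _).
  by rewrite ltn_neqAle eq_sym szq size_poly_gt0.
by exists pi => //; apply: dvdp_trans dvq.
Qed.

(** Divisibility by a polynomial in x, tested on the coefficients because
    these lie over a field. *)
Definition content_dvd pi f := forall i, pi %| f`_i.

Lemma content_dvdP pi f : content_dvd pi f <-> exists g, f = pi%:P * g.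
Proof.
split=> [dv|[g ->] i]; last by rewrite coefCM dvdp_mulr.
exists (\poly_(i < size f) (f`_i %/ pi)); apply/polyP => i.
rewrite coefCM coef_poly; case: ltnP => [_|le_i]; first by rewrite mulrC divpK.
by rewrite mulr0 nth_default.
Qed.

(** For the first coefficients of [f] and [g] that [pi] does not divide, of
    indices i and j, every other term of the coefficient i + j of [f * g] is
    divisible by [pi]. *)
Lemma gauss_content pi f g : irreducible_poly pi ->
  content_dvd pi (f * g) -> content_dvd pi f \/ content_dvd pi g.
Proof.
move=> irr dv; apply: NNPP => /not_or_and[nf ng].
have first_coef h : ~ content_dvd pi h ->
    exists i, ~~ (pi %| h`_i) /\ forall j, (j < i)%N -> pi %| h`_j.
  move=> nh; have /ex_min_nat[i [ndi mini]] : exists i, ~~ (pi %| h`_i).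
    by apply: NNPP => no_i; apply: nh => i; apply/negPn/negP => ndi; apply: no_i;
      exists i.
  exists i; split=> // j lt_ji; apply/negPn/negP => ndj.
  by have := mini _ ndj; rewrite leqNgt lt_ji.
have [i [ndi lowi]] := first_coef f nf; have [j [ndj lowj]] := first_coef g ng.
have lt_i : (i < (i + j).+1)%N by rewrite ltnS leq_addr.
have := dv (i + j)%N; rewrite coefM (bigD1 (Ordinal lt_i)) //= dvdp_addl; last first.
  apply: (big_ind (fun x => pi %| x)) => [|x y dx dy|u ne_u]; first exact: dvdp0.
    exact: dvdp_add.
  have := ltn_ord u; rewrite ltnS => le_u.
  case: (ltngtP u i) => [lt_ui|lt_iu|eui].
  - by rewrite dvdp_mulr ?lowi.
  - by rewrite dvdp_mull // lowj //; lia.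
  - by move: ne_u; rewrite -val_eqE /= eui eqxx.
by rewrite addKn Gauss_dvdpr ?(negPf ndj) // irreducible_poly_coprime.
Qed.

Definition primitive h := forall pi, irreducible_poly pi -> ~ content_dvd pi h.

(** Dividing by an irreducible factor of the content lowers the degree of the
    leading coefficient. *)
Lemma primitive_part h : h != 0 ->
  exists c h', [/\ c != 0, h = c%:P * h' & primitive h'].
Proof.
have [n eqn] : exists n, size (lead_coef h) = n by exists (size (lead_coef h)).
elim/ltn_ind: n h eqn => n IHn h szh h0.
case: (classic (primitive h)) => [prim|nprim].
  by exists 1, h; rewrite oner_neq0 mul1r.
have [pi [irr /content_dvdP[g eh]]] : exists pi, irreducible_poly pi /\ content_dvd
  pi h.
  apply: NNPP => no_pi; apply: nprim => pi irr dv; apply: no_pi; by exists pi.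
have g0 : g != 0 by apply: contraNneq h0 => g0; rewrite eh g0 mulr0.
have pi0 := irredp_neq0 irr.
have lt_g : (size (lead_coef g) < n)%N.
  rewrite -szh eh lead_coefM lead_coefC size_mul ?lead_coef_eq0 //.
  have [sz_pi _] := irr; have : (0 < size (lead_coef g))%N by rewrite size_poly_gt0
    lead_coef_eq0.
  by move: sz_pi; move: (size _) (size _) => u v; lia.
have [c [h' [c0 eg prim]]] := IHn _ lt_g g (erefl _) g0.
exists (pi * c), h'; split=> //; first by rewrite mulf_neq0.
by rewrite eh eg polyCM mulrA.
Qed.

(** The irreducible factors of [c] can be removed one at a time: by
    [gauss_content] each of them divides [q]. *)
Lemma primitive_cancel c h f q : primitive h -> c != 0 -> c%:P * f = q * h ->
  exists q', f = q' * h.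
Proof.
move=> prim.
have [n eqn] : exists n, size c = n by exists (size c).
elim/ltn_ind: n c q eqn => n IHn c q szc c0 eqf.
have [sz1|sz1] := leqP (size c) 1.
  have ec := size1_polyC sz1; have u0 : c`_0 != 0 by rewrite -polyC_eq0 -ec.
  exists (((c`_0)^-1)%:P%:P * q); rewrite -mulrA -eqf mulrA -polyCM.
  have -> : ((c`_0)^-1)%:P * c = 1 by rewrite {2}ec -polyCM mulVf ?polyC1.
  by rewrite polyC1 mul1r.
have [pi irr /dvdpP[c1 ec]] := irreducible_divisor sz1.
have pi0 := irredp_neq0 irr.
have c10 : c1 != 0 by apply: contraNneq c0 => e; rewrite ec e mul0r.
have [|/content_dvdP[q1 eq1]|/(prim _ irr)//] := @gauss_content pi q h irr.
  by apply/content_dvdP; exists (c1%:P * f); rewrite -eqf ec polyCM; ring.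
have piP0 : pi%:P != 0 by rewrite polyC_eq0.
apply: (IHn (size c1) _ c1 q1) => //.
  rewrite -szc ec size_mul //; have [sz_pi _] := irr.
  have : (0 < size c1)%N by rewrite size_poly_gt0.
  by move: sz_pi; move: (size _) (size _) => u v; lia.
by apply: (mulfI piP0); rewrite mulrA -polyCM [pi * c1]mulrC -ec eqf eq1 mulrA.
Qed.

End Gauss.

(** * From differential ideals to Darboux polynomials *)
Section DarbouxOfIdeal.
Variables (k : fieldType) (d : {poly {poly k}} -> {poly {poly k}}).
Variable I : {poly {poly k}} -> Prop.
Hypotheses (der_d : derivation d) (ideal_I : ideal I) (diff_I : differential d I).

(** The contraction to k[x][y] of the ideal generated by [I] in k(x)[y]. *)
Definition saturation (f : {poly {poly k}}) :=
  exists2 c : {poly k}, c != 0 & I (c%:P * f).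

Lemma saturation_ideal : ideal saturation.
Proof.
have [I0 ID IM] := ideal_I; split.
- by exists 1; rewrite ?oner_neq0 ?mulr0.
- move=> f g [c c0 If] [e e0 Ig]; exists (c * e); first by rewrite mulf_neq0.
  have -> : (c * e)%:P * (f + g) = e%:P * (c%:P * f) + c%:P * (e%:P * g).
    by rewrite polyCM; ring.
  by apply: ID; apply: IM.
- by move=> f g [c c0 Ig]; exists c => //; rewrite mulrCA; apply: IM.
Qed.

Lemma saturation_differential : differential d saturation.
Proof.
have [_ _ IM] := ideal_I; have [_ dM] := der_d.
move=> f [c c0 If]; exists (c ^+ 2); first by rewrite expf_neq0.
have -> : (c ^+ 2)%:P * d f = c%:P * d (c%:P * f) - d c%:P * (c%:P * f).
  by rewrite dM expr2 polyCM; ring.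
by apply: idealB => //; apply: IM => //; apply: diff_I.
Qed.

Lemma saturation_cancel c f : c != 0 -> saturation (c%:P * f) -> saturation f.
Proof.
by move=> c0 [e e0 If]; exists (e * c); rewrite ?mulf_neq0 // polyCM -mulrA.
Qed.

(** A primitive element [h] of least degree of the saturation generates it:
    pseudo-division gives this up to a factor in k[x], which
    [primitive_cancel] removes. As the saturation is differential, [h] divides
    [d h]. *)
Lemma darboux_of_ideal f : f != 0 -> I f ->
    (forall g : {poly k}, I g%:P -> g = 0) ->
  exists h lam : {poly {poly k}}, (1 < size h)%N /\ d h = lam * h.
Proof.
move=> f0 If noX; have [J0 JD JM] := saturation_ideal.
have JnoX g : saturation g%:P -> g = 0.
  move=> [c c0]; rewrite -polyCM => /noX /eqP.
  by rewrite mulf_eq0 (negPf c0) => /eqP.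
pose P n := exists h : {poly {poly k}}, [/\ h != 0, saturation h & size h = n].
have [n [[h1 [h10 Jh1 szh1]] minn]] : exists n, P n /\ forall m, P m -> (n <= m)%N.
  apply: ex_min_nat; exists (size f), f; split=> //.
  by exists 1; rewrite ?oner_neq0 // mul1r.
have [c [h [c0 eh prim]]] := primitive_part h10.
have h0 : h != 0 by apply: contraNneq h10 => h0; rewrite eh h0 mulr0.
have Jh : saturation h by apply: (saturation_cancel c0); rewrite -eh.
have szh : size h = n by rewrite -szh1 eh mul_polyC size_scale.
have dvdJ g : saturation g -> exists q, g = q * h.
  move=> Jg; have eqg := Pdiv.Idomain.divp_eq g h.
  have J_rem : saturation (g %% h).
    have -> : g %% h = (lead_coef h ^+ scalp g h)%:P * g - (g %/ h) * h.
      by rewrite mul_polyC eqg addrAC subrr add0r.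
    by apply: (idealB saturation_ideal); apply: JM.
  have rem0 : g %% h = 0.
    apply/eqP; apply/negPn/negP => rem0.
    have : P (size (g %% h)) by exists (g %% h).
    by move/minn; rewrite leqNgt -szh ltn_modpN0.
  apply: (primitive_cancel prim (c := lead_coef h ^+ scalp g h) (q := g %/ h)).
    by rewrite expf_neq0 // lead_coef_eq0.
  by rewrite mul_polyC eqg rem0 addr0.
have [lam elam] := dvdJ _ (saturation_differential Jh).
exists h, lam; split=> //; rewrite ltnNge; apply/negP => /size1_polyC eh'.
by move: h0; rewrite eh' (JnoX h`_0) ?polyC0 ?eqxx // -eh'.
Qed.

End DarbouxOfIdeal.

Section Simplicity.
Variable k : fieldType.
Hypothesis char0 : [pchar k] =i pred0.
Implicit Types (f g lam Q : {poly {poly k}}).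

Lemma bider_derivation r Q : derivation (bider r Q).
Proof.
rewrite /bider; split=> f g; first by rewrite deriv_innerD derivD; ring.
by rewrite deriv_innerM derivM; ring.
Qed.

(** If [I] contains a nonzero polynomial in x, then it contains a power of
    y^r and, when r > 0, also a power of [Q]; these are comaximal since
    [b != 0] is the value of [Q] at y = 0. *)
Lemma simple_bider (a b : k) r s p q : a != 0 -> b != 0 -> (0 < s)%N ->
    [\/ (q < p)%N, [/\ r = 0%N, (p < q)%N & (1 < s)%N] |
       [/\ r = 0%N, s = 1%N, (p < q)%N & ~~ (p.+1 %| q - p)%N]] ->
    ((0 < r)%N -> q = 0%N) ->
  simple_derivation (bider r (mono a p s + mono b q 0)).
Proof.
move=> a0 b0 s0 regime q0; set Q := _ + _.
split=> [|I idI diI]; first exact: bider_derivation.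
have der := bider_derivation r Q; have [I0 ID IM] := idI.
case: (classic (exists2 f, f != 0 & I f)) => [[f f0 If]|no_f]; last first.
  left=> f; split=> [If|->//]; apply/eqP/negPn/negP => f0.
  by apply: no_f; exists f.
right; suff I1 : I 1 by move=> g; rewrite -[g]mulr1; apply: IM.
have [noX|[g [g0 Ig]]] : (forall g : {poly k}, I g%:P -> g = 0) \/
    exists g : {poly k}, g != 0 /\ I g%:P.
  case: (classic (exists g : {poly k}, g != 0 /\ I g%:P)); first by right.
  move=> no_g; left=> g Ig; apply/eqP/negPn/negP => g0.
  by apply: no_g; exists g.
  have [h [lam [szh eqh]]] := darboux_of_ideal der idI diI f0 If noX.
  have h0 : h != 0 by rewrite -size_poly_gt0 ltnW.
  have := darboux_size1 char0 a0 b0 s0 regime h0 eqh.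
  by rewrite leqNgt szh.
have [N IN] : exists N, I (('X^r) ^+ N).
  apply: (differential_power der idI diI (e := polyC) char0 _ _ g0 Ig) => [h|c c0].
    by rewrite /bider deriv_innerC derivC mulr0 addr0.
  by exists (c^-1)%:P%:P; rewrite -!polyCM mulVf ?polyC1.
case: (posnP r) => [r0|r_gt0]; first by move: IN; rewrite r0 expr0 expr1n.
have [M IM'] : exists M, I (Q ^+ M).
  apply: (differential_power der idI diI (e := map_poly polyC) char0 _ _ (g :=
    'X^(r * N))).
  - move=> h; rewrite /bider deriv_map; have -> : deriv_inner h^:P = 0.
      by apply/polyP => i; rewrite coef_deriv_inner coef_map derivC coef0.
    by rewrite mulr0 add0r.
  - move=> c c0; exists (c^-1)%:P%:P; rewrite map_polyC /= -!polyCM mulVf ?polyC1 //.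
  - by rewrite monic_neq0 ?monicXn.
  - by rewrite map_polyXn exprM.
have bV : (b^-1)%:P%:P * b%:P%:P = 1 :> {poly {poly k}}.
  by rewrite -!polyCM mulVf ?polyC1.
pose Q1 := (a%:P * 'X^p)%:P * 'X^(s.-1).
apply: (comaximal_powers idI (u := 'X) (v := Q) (m := (r * N)%N) (n := M)
  (al := - (b^-1)%:P%:P * Q1) (be := (b^-1)%:P%:P)) => //; last first.
  by rewrite exprM.
rewrite -[RHS]bV /Q /mono (q0 r_gt0) !expr0 !mulr1 -[in 'X^s](prednK s0) exprS /Q1.
by ring.
Qed.

End Simplicity.

(** * Invariant curves that obstruct simplicity *)
Section Obstructions.
Variable k : fieldType.
Hypothesis char0 : [pchar k] =i pred0.
Implicit Types (F lam Q : {poly {poly k}}) (g h : {poly k}).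

Lemma mul1_size (R : idomainType) (p q : {poly R}) : p * q = 1 -> size p = 1%N.
Proof.
move=> pq1; have : p * q != 0 by rewrite pq1 oner_neq0.
rewrite mulf_eq0 negb_or => /andP[p0 q0].
have := congr1 (fun f : {poly R} => size f) pq1; rewrite size_mul // size_poly1.
move: p0 q0; rewrite -!size_poly_gt0.
by move: (size p) (size q) => u v; lia.
Qed.

Lemma simple_darboux_size (d : {poly {poly k}} -> {poly {poly k}}) F lam :
  simple_derivation d -> F != 0 -> d F = lam * F -> size F = 1%N.
Proof.
move=> [[dD dM] simp] F0 eqF.
pose I (f : {poly {poly k}}) := exists u : {poly {poly k}}, f = F * u.
have idI : ideal I.
  split; first by exists 0; rewrite mulr0.
  - by move=> f g [u ->] [v ->]; exists (u + v); rewrite mulrDr.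
  - by move=> f g [v ->]; exists (f * v); rewrite mulrCA.
have diI : differential d I.
  by move=> f [u ->]; exists (d u + u * lam); rewrite dM eqF; ring.
case: (simp I idI diI) => [I0|I1].
  have : F = 0 by apply/I0; exists 1; rewrite mulr1.
  by move/eqP; rewrite (negPf F0).
have [h /esym eh] := I1 1; exact: mul1_size eh.
Qed.

(** If [g] has positive degree, its zeros are invariant lines. If it is a
    constant c, then (t + 1) y^(r+1) - c (r + 1) x^(t+1) is a first
    integral. *)
Lemma separated_not_simple r t g : ~ simple_derivation (bider r (('X^t)%:P * g^:P)).
Proof.
set Q := _ * _ => simp.
have [sz1|sz1] := ltnP 1 (size g).
  have : size g^:P = 1%N.
    apply: (simple_darboux_size simp (lam := ('X^t)%:P * (g^`())^:P)).
      by rewrite -size_poly_eq0 size_map_polyC -lt0n ltnW.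
    rewrite /bider deriv_map; have -> : deriv_inner g^:P = 0.
      by apply/polyP => i; rewrite coef_deriv_inner coef_map derivC coef0.
    by rewrite /Q; ring.
  by rewrite size_map_polyC => e; rewrite e in sz1.
pose c := g`_0.
pose F : {poly {poly k}} := t.+1%:R * 'X^(r.+1) - (c%:P * r.+1%:R * 'X^(t.+1))%:P.
have coefF : F`_r.+1 = t.+1%:R.
  by rewrite coefB -polyC_natr coefCM coefXn eqxx mulr1 coefC subr0.
have Fr0 : F`_r.+1 != 0.
  by rewrite coefF -polyC_natr polyC_eq0 natr_neq0.
have F0 : F != 0 by apply: contraNneq Fr0 => ->; rewrite coef0.
have szF : size F = 1%N.
  apply: (simple_darboux_size simp (lam := 0)) => //; rewrite mul0r.
  have dXr : ('X^(r.+1))^`() = r.+1%:R * 'X^r :> {poly {poly k}}.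
    by rewrite derivXn mulr_natl.
  have dXt : ('X^(t.+1))^`() = t.+1%:R * 'X^t :> {poly k} by rewrite derivXn mulr_natl.
  rewrite /bider /Q (size1_polyC sz1) -/c map_polyC /= /F.
  rewrite deriv_innerB deriv_innerM deriv_innerC deriv_innerXn derivB derivC
    -!polyC_natr !deriv_innerC.
  rewrite !derivC derivM derivC dXr mulr0 !mul0r !add0r subr0.
  have -> : (c%:P * r.+1%:R%:P * 'X^(t.+1))^`() = c%:P * r.+1%:R%:P * (t.+1%:R * 'X^t).
    by rewrite -polyCM derivM derivC dXt; ring.
  by rewrite !polyCM !polyC_natr -!polyC_natr; ring.
by move: Fr0; rewrite nth_default ?eqxx // szF.
Qed.

(** The ideal (y^r, Q) is differential and contains y^r, so it contains 1;
    this is read off at y = 0. *)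
Lemma size_coef0_simple r Q : (0 < r)%N -> simple_derivation (bider r Q) ->
  size (Q`_0)%R = 1%N.
Proof.
move=> r0 [[dD dM] simp].
pose I (f : {poly {poly k}}) := exists u v : {poly {poly k}}, f = 'X^r * u + Q * v.
have idI : ideal I.
  split; first by exists 0, 0; rewrite !mulr0 addr0.
  - by move=> f g [u [v ->]] [u' [v' ->]]; exists (u + u'), (v + v'); ring.
  - by move=> f g [u [v ->]]; exists (f * u), (f * v); ring.
have dXr : ('X^r)^`() = r%:R * 'X^(r.-1) :> {poly {poly k}} by rewrite derivXn
  mulr_natl.
have diI : differential (bider r Q) I.
  move=> f [u [v ->]].
  exists (bider r Q u + deriv_inner Q * v), (r%:R * 'X^(r.-1) * u + Q^`() * v +
    bider r Q v).
  by rewrite dD !dM /bider deriv_innerXn dXr; ring.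
have [I0|I1] := simp I idI diI.
  have : 'X^r = 0 :> {poly {poly k}} by apply/I0; exists 1, 0;
    rewrite mulr1 mulr0 addr0.
  by move/eqP; rewrite (negPf (monic_neq0 (monicXn _ _))).
have [u [v /esym euv]] := I1 1.
have := congr1 (fun f : {poly {poly k}} => f`_0) euv.
by rewrite coefD coefXnM r0 add0r coef0M coefC; apply: mul1_size.
Qed.

(** Substituting h - (b / a) x^(m (p + 1)) for h lowers the exponent of the
    inhomogeneous term by p + 1; at exponent p a constant is a solution. *)
Lemma linear_ode_solution (a b : k) p m : a != 0 ->
  exists h, h^`() = a%:P * 'X^p * h + b%:P * 'X^(p + m * p.+1).
Proof.
move=> a0; elim: m b => [|m IHm] b.
  exists (- (a^-1 * b))%:P; rewrite derivC addn0 mulrAC -polyCM mulrN mulrA divff //.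
  by rewrite mul1r polyCN mulNr addNr.
pose n := (m.+1 * p.+1)%N.
have [h1 eh1] := IHm (a^-1 * b * n%:R).
exists (h1 - (a^-1 * b)%:P * 'X^n).
have -> : (h1 - (a^-1 * b)%:P * 'X^n)^`() = h1^`() - (a^-1 * b * n%:R)%:P * 'X^(n.-1).
  by rewrite derivB deriv_mulC derivXn (polyCM _ n%:R) polyC_natr -mulr_natl mulrA.
have -> : n.-1 = (p + m * p.+1)%N by rewrite /n mulSn addSn.
have e1 : a%:P * 'X^p * ((a^-1 * b)%:P * 'X^n) = b%:P * 'X^(p + n).
  by rewrite mulrACA -polyCM mulVKf // -exprD.
by rewrite mulrBr e1 eh1; ring.
Qed.

Lemma mono_separated (c : k) t s : mono c t s = ('X^t)%:P * (c%:P * 'X^s)^:P.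
Proof.
have mapM (g h : {poly k}) : (g * h)^:P = g^:P * h^:P by exact: rmorphM.
by rewrite /mono polyCM mapM map_polyC map_polyXn; ring.
Qed.

Lemma map_polyC_D (g h : {poly k}) : (g + h)^:P = g^:P + h^:P.
Proof. exact: rmorphD. Qed.

Lemma mono0 t s : mono (0 : k) t s = 0.
Proof. by rewrite /mono polyC0 mul0r polyC0 mul0r. Qed.

(** The hypothesis makes the graph y = h(x) invariant. *)
Lemma graph_darboux Q (g h : {poly k}) :
  Q - (h^`())%:P = g%:P * ('X - h%:P) -> ~ simple_derivation (bider 0 Q).
Proof.
move=> eqQ simp; have F0 : 'X - h%:P != 0 by rewrite polyXsubC_eq0.
have := simple_darboux_size (lam := g%:P) simp F0; rewrite size_XsubC.
suff -> : bider 0 Q ('X - h%:P) = g%:P * ('X - h%:P) by move/(_ erefl).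
rewrite -eqQ /bider expr0 deriv_innerB deriv_innerC deriv_innerX derivB derivX
  derivC; ring.
Qed.

Lemma bider_simple_iff r t1 s1 t2 s2 (c1 c2 : k) :
    (t2 <= t1)%N -> (t1, s1) <> (t2, s2) ->
  simple_derivation (bider r (mono c1 t1 s1 + mono c2 t2 s2)) <->
  [/\ [/\ c1 != 0, c2 != 0 & (t2 < t1)%N],
      (0 < r)%N -> [/\ t2 = 0%N, s2 = 0%N & (0 < s1)%N],
      r = 0%N -> (0 < s1 + s2)%N /\ (s1 * s2)%N = 0%N
    & r = 0%N -> s1 = 0%N -> s2 = 1%N -> ~ (t2.+1 %| t1 - t2)%N].
Proof.
move=> le_t neq_ts; split=> [simp|[[c10 c20 lt_t] cond_b cond_c cond_d]]; last first.
  have [r0|r_gt0] := posnP r.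
    have [s12 /eqP] := cond_c r0; rewrite muln_eq0 => /orP[]/eqP s_0.
      rewrite s_0 addrC in s12 *.
      apply: simple_bider => //; last by rewrite r0.
      have [s2_1|s2_gt1] : s2 = 1%N \/ (1 < s2)%N by move: s12;
        case: (s2) => [|[|n]] // _; [left|right].
        by apply: Or33; split=> //; apply/negP; apply: cond_d.
      by apply: Or32.
    rewrite s_0 addn0 in s12 *.
    apply: simple_bider => //; last by rewrite r0.
    exact: Or31.
  have [et2 es2 s1_gt0] := cond_b r_gt0; rewrite es2.
  by apply: simple_bider => //; apply: Or31.
have cond_a : [/\ c1 != 0, c2 != 0 & (t2 < t1)%N].
  split.
  - apply/negP => /eqP c10; move: simp; rewrite c10 mono0 add0r mono_separated.
    exact: separated_not_simple.
  - apply/negP => /eqP c20; move: simp; rewrite c20 mono0 addr0 mono_separated.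
    exact: separated_not_simple.
  - rewrite ltn_neqAle le_t andbT; apply/negP => /eqP et; move: simp.
    rewrite et !mono_separated -mulrDr -map_polyC_D; exact: separated_not_simple.
have [c10 c20 lt_t] := cond_a; split=> //.
- move=> r_gt0; have := size_coef0_simple r_gt0 simp.
  have coef0_mono c t s : (mono c t s)`_0 = if s == 0%N then c%:P * 'X^t else 0 :>
    {poly k}.
    by rewrite coefCM coefXn eq_sym; case: eqP; rewrite ?mulr1 ?mulr0.
  have szXt c t : c != 0 -> size (c%:P * 'X^t : {poly k}) = t.+1.
    by move=> c0; rewrite mul_polyC size_scale ?size_polyXn.
  rewrite coefD !coef0_mono; case: (posnP s1) => [s10|s1_gt0] /=.
    rewrite size_polyDl ?szXt //; first by move: lt_t; case: (t1).
    by case: ifP => _; rewrite ?size_poly0 ?szXt.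
  rewrite add0r; case: eqP => [s20|_]; last by rewrite size_poly0.
  by rewrite szXt // => -[t20].
- move=> r0; rewrite r0 in simp; split; last first.
    apply/eqP/negPn/negP; rewrite muln_eq0 negb_or -!lt0n => /andP[s1_gt0 s2_gt0].
    pose Q1 := (c1%:P * 'X^t1)%:P * 'X^(s1.-1) + (c2%:P * 'X^t2)%:P * 'X^(s2.-1).
    have := simple_darboux_size (F := 'X) (lam := Q1) simp.
    rewrite polyX_eq0 size_polyX => /(_ isT) H.
    suff /H : bider 0 (mono c1 t1 s1 + mono c2 t2 s2) 'X = Q1 * 'X by [].
    rewrite /bider deriv_innerX derivX /mono /Q1.
    by rewrite -[in LHS](prednK s1_gt0) -[in LHS](prednK s2_gt0) !exprS; ring.
  rewrite lt0n addn_eq0; apply/negP => /andP[/eqP s10 /eqP s20].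
  have prim c t : exists h : {poly k}, h^`() = c%:P * 'X^t.
    exists ((c / t.+1%:R)%:P * 'X^(t.+1)).
    have dXt : ('X^(t.+1))^`() = (t.+1%:R)%:P * 'X^t :> {poly k}.
      by rewrite derivXn polyC_natr mulr_natl.
    by rewrite deriv_mulC dXt mulrA -polyCM divfK ?natr_neq0.
  have [h1 eh1] := prim c1 t1; have [h2 eh2] := prim c2 t2.
  apply: (graph_darboux (g := 0) (h := h1 + h2)) simp.
  by rewrite s10 s20 /mono !expr0 !mulr1 derivD eh1 eh2 polyCD subrr mul0r.
- move=> r0 s10 s21 /dvdnP[m em]; rewrite r0 s10 s21 in simp.
  have [h eh] := linear_ode_solution c1 t2 m c20.
  apply: (graph_darboux (g := c2%:P * 'X^t2) (h := h)) simp.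
  rewrite eh -em subnKC // /mono expr0 expr1 !polyCD !polyCM; ring.
Qed.

End Obstructions.

(** * Transport to polynomials in two variables *)
Lemma simple_derivation_transport (A B : comNzRingType) (phi : {rmorphism A -> B})
    (psi : B -> A) (d : A -> A) (e : B -> B) :
    cancel psi phi -> (forall a, phi (d a) = e (phi a)) -> injective phi ->
  simple_derivation d -> simple_derivation e.
Proof.
move=> psiK de inj_phi [[dD dM] simp]; split.
  split=> x y; rewrite -[x]psiK -[y]psiK.
    by rewrite -rmorphD -!de dD rmorphD.
  by rewrite -rmorphM -!de dM rmorphD !rmorphM.
move=> I [I0 ID IM] diI.
have [||I0'|I1] := simp (fun a => I (phi a)).
- split=> [|a b Ia Ib|a b Ib]; rewrite ?rmorph0 // ?rmorphD ?rmorphM;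
    by [apply: ID | apply: IM].
- by move=> a Ia; rewrite de; apply: diI.
- left=> x; rewrite -[x]psiK; split=> [/I0' ->|]; first by rewrite rmorph0.
  by rewrite -(rmorph0 phi) => /inj_phi ->; rewrite rmorph0.
by right=> x; rewrite -[x]psiK.
Qed.

Section Transport.
Variable k : fieldType.

Local Notation A := {mpoly k[2]}.
Local Notation B := {poly {poly k}}.

(** The first variable becomes the inner one and the second the outer one, as
    in [bider]. *)
Definition to_bipoly : {rmorphism A -> B} :=
  mmap (polyC \o polyC) (fun i : 'I_2 => if i == ord0 then 'X%:P else 'X).

Definition of_unipoly : {rmorphism {poly k} -> A} :=
  horner_eval (varx k) \o map_poly (@mpolyC 2 k).

Definition of_bipoly : {rmorphism B -> A} :=
  horner_eval (vary k) \o map_poly of_unipoly.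

Lemma to_bipolyC c : to_bipoly c%:MP = c%:P%:P.
Proof. exact: mmapC. Qed.

Lemma to_bipolyX i : to_bipoly 'X_i = if i == ord0 then 'X%:P else 'X.
Proof. by rewrite /= mmapX mmap1U. Qed.

Lemma of_bipolyX : of_bipoly 'X = vary k.
Proof. by rewrite /= map_polyX /horner_eval hornerX. Qed.

Lemma of_bipolyY : of_bipoly 'X%:P = varx k.
Proof.
by rewrite /= map_polyC /horner_eval hornerC /= map_polyX /horner_eval hornerX.
Qed.

Lemma of_bipolyC c : of_bipoly c%:P%:P = c%:MP.
Proof.
by rewrite /= map_polyC /horner_eval hornerC /= map_polyC /horner_eval hornerC.
Qed.

Lemma to_bipolyK : cancel to_bipoly of_bipoly.
Proof.
elim/mpolyind => [|c m p _ _ IHp]; first by rewrite !rmorph0.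
rewrite !rmorphD IHp -mul_mpolyC !rmorphM to_bipolyC of_bipolyC; congr (_ * _ + _).
rewrite mpolyXE_id !rmorph_prod; apply: eq_bigr => i _; rewrite !rmorphXn to_bipolyX.
congr (_ ^+ _); case: (unliftP ord0 i) => [j ->|->]; last by rewrite eqxx of_bipolyY.
rewrite eq_sym (negPf (neq_lift _ _)) of_bipolyX /vary.
by congr 'X_ _; apply/val_inj => /=; case: j => -[].
Qed.

Lemma of_bipolyK : cancel of_bipoly to_bipoly.
Proof.
have inner g : to_bipoly (of_bipoly g%:P) = g%:P.
  elim/poly_ind: g => [|g c IHg]; first by rewrite polyC0 !rmorph0.
  rewrite polyCD polyCM !rmorphD !rmorphM IHg of_bipolyC to_bipolyC of_bipolyY.
  by rewrite to_bipolyX.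
elim/poly_ind => [|F g IHF]; first by rewrite !rmorph0.
by rewrite !rmorphD !rmorphM IHF inner of_bipolyX to_bipolyX.
Qed.

Lemma of_bipoly_mono c i j :
  of_bipoly (mono c i j) = c *: (varx k ^+ i * vary k ^+ j).
Proof.
have ofM : {morph of_bipoly : a b / a * b} by exact: rmorphM.
have ofX n : {morph of_bipoly : a / a ^+ n} by exact: rmorphXn.
by rewrite /mono polyCM polyC_exp !ofM !ofX of_bipolyX of_bipolyY of_bipolyC
           -mulrA mul_mpolyC.
Qed.

(** The conjugate of [bider] is a k-derivation with the right values at the
    two variables, and there is only one such derivation. *)
Lemma plane_derivation_bider r t1 s1 t2 s2 (c1 c2 : k) f :
  to_bipoly (plane_derivation (vary k ^+ r)
       (c1 *: (varx k ^+ t1 * vary k ^+ s1) + c2 *: (varx k ^+ t2 * vary k ^+ s2)) f)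
  = bider r (mono c1 t1 s1 + mono c2 t2 s2) (to_bipoly f).
Proof.
set Q := (X in bider r X).
have [bD bM] := bider_derivation r Q.
have scale c g : c *: of_bipoly g = of_bipoly (c%:P%:P * g).
  by rewrite rmorphM of_bipolyC mul_mpolyC.
have ofD : {morph of_bipoly : a b / a + b} by exact: rmorphD.
have toD : {morph to_bipoly : a b / a + b} by exact: rmorphD.
have toM : {morph to_bipoly : a b / a * b} by exact: rmorphM.
rewrite -(@plane_derivation_unique _ _ _ (of_bipoly \o bider r Q \o to_bipoly)).
- by rewrite /comp of_bipolyK.
- split; first split=> a b; rewrite /comp.
  + by rewrite toD bD rmorphD.
  + by rewrite toM bM rmorphD !rmorphM !to_bipolyK.
  move=> c g; rewrite /comp -mul_mpolyC toM to_bipolyC bM.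
  have -> : bider r Q c%:P%:P = 0.
    by rewrite /bider deriv_innerC !derivC polyC0 !mulr0 addr0.
  by rewrite mulr0 addr0 scale.
- rewrite /comp /varx to_bipolyX eqxx /bider deriv_innerC derivX derivC mulr0 addr0.
  by rewrite polyC1 mulr1 rmorphXn of_bipolyX.
- have to_y : to_bipoly (vary k) = 'X by rewrite /vary to_bipolyX.
  rewrite /comp to_y /bider deriv_innerX derivX mulr0 add0r mulr1.
  by rewrite /Q ofD !of_bipoly_mono.
Qed.

End Transport.

Theorem theorem5p1 (k : fieldType) (char0 : [pchar k] =i pred0)
    (r t1 s1 t2 s2 : nat) (c1 c2 : k)
    (le_t : (t2 <= t1)%N) (neq_ts : (t1, s1) <> (t2, s2)) :
  simple_derivation
    (plane_derivation (vary k ^+ r)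
       (c1 *: (varx k ^+ t1 * vary k ^+ s1)
        + c2 *: (varx k ^+ t2 * vary k ^+ s2)))
  <->
  [/\ [/\ c1 != 0, c2 != 0 & (t2 < t1)%N],
      (0 < r)%N -> [/\ t2 = 0%N, s2 = 0%N & (0 < s1)%N],
      r = 0%N -> (0 < s1 + s2)%N /\ (s1 * s2)%N = 0%N
    & r = 0%N -> s1 = 0%N -> s2 = 1%N -> ~ (t2.+1 %| t1 - t2)%N].
Proof.
rewrite -(bider_simple_iff char0 r c1 c2 le_t neq_ts).
have conj := plane_derivation_bider r t1 s1 t2 s2 c1 c2.
split; apply: simple_derivation_transport.
- exact: of_bipolyK.
- exact: conj.
- exact: can_inj (@to_bipolyK k).
- exact: to_bipolyK.
- by move=> F; apply: (can_inj (@to_bipolyK k)); rewrite conj !of_bipolyK.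
- exact: can_inj (@of_bipolyK k).
Qed.
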